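(* Assume the Continuum Hypothesis. Then there exists a maximal almost disjoint family $\mathcal{F}$ of infinite subsets of $\mathbb{N}$ such that: (i) no sequence in $\ell_1(\mathbb{N})\subset C(K_\mathcal{F})^*$ is $w^*$-convergent to $\delta_\infty$; (ii) the Banach space $C(K_\mathcal{F})$ is not fully Mackey complete.
   Context: An almost disjoint family is an infinite family of pairwise almost disjoint infinite subsets of $\mathbb{N}$ (two sets are almost disjoint if their intersection is finite); it is maximal if it is maximal with respect to inclusion among almost disjoint families. $K_\mathcal{F}$ is the Stone space of the Boolean algebra generated by $\mathcal{F}$ and the finite subsets of $\mathbb{N}$; it decomposes as $K_\mathcal{F}=\mathbb{N}\cup\{u_N:N\in\mathcal{F}\}\cup\{\infty\}$, where points of $\mathbb{N}$ are isolated, basic neighbourhoods of $u_N$ are $\{u_N\}\cup(N\setminus F)$ with $F\subset\mathbb{N}$ finite, and basic neighbourhoods of $\infty$ are $K_\mathcal{F}\setminus\bigcup_{N\in\mathcal{F}_0}(\{u_N\}\cup N)$ with $\mathcal{F}_0\subset\mathcal{F}$ finite. $C(K_\mathcal{F})$ carries the supremum norm; $\delta_t\in C(K_\mathcal{F})^*$ is evaluation at $t$, and $\ell_1(\mathbb{N})$ is identified with the closed subspace of $C(K_\mathcal{F})^*$ consisting of the elements $\sum_{n}\lambda_n\delta_n$ with $\sum_n|\lambda_n|<\infty$. A subspace $Y\subset Z^*$ of the dual of a Banach space $Z$ is norming if $|||z|||=\sup\{z^*(z): z^*\in Y,\ \|z^*\|\le1\}$ is an equivalent norm on $Z$; $Z$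 is fully Mackey complete if $(Z,\mu(Z,Y))$ is complete for every norming and norm-closed subspace $Y\subset Z^*$, where $\mu(Z,Y)$ is the topology of uniform convergence on absolutely convex $w^*$-compact subsets of $Y$. *)

(* Defs.v *)
From HB Require Import structures.
From mathcomp Require Import all_boot all_order all_algebra.
From mathcomp Require Import all_classical all_reals all_analysis.
From Stdlib Require List.
Set Implicit Arguments. Unset Strict Implicit. Unset Printing Implicit Defensive.
Import Order.TTheory GRing.Theory Num.Theory.
Import numFieldNormedType.Exports.
Local Open Scope classical_set_scope.
Local Open Scope ring_scope.

Definition CH : Prop :=
  forall A : set (set nat), countable A \/ (A #= [set: set nat])%card.

Definition almost_disjoint_family (F : set (set nat)) : Prop :=
  infinite_set F /\
  (forall N, F N -> infinite_set N) /\
  (forall N M, F N -> F M -> N <> M -> finite_set (N `&` M)).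

Definition maximal_adf (F : set (set nat)) : Prop :=
  almost_disjoint_family F /\
  (forall G, almost_disjoint_family G -> F `<=` G -> G = F).

Inductive Kpt (F : set (set nat)) : Type :=
  | KN : nat -> Kpt F
  | KU : {N : set nat | F N} -> Kpt F
  | KInf : Kpt F.
Arguments KN {F}. Arguments KU {F}. Arguments KInf {F}.

Definition basic_nbhd (F : set (set nat)) (t : Kpt F) (V : set (Kpt F)) : Prop :=
  match t with
  | KN n => V = [set KN n]
  | KU N => exists Fin : set nat, finite_set Fin /\
       V = [set s | s = KU N \/ exists m, s = KN m /\ proj1_sig N m /\ ~ Fin m]
  | KInf => exists F0 : set (set nat), finite_set F0 /\ F0 `<=` F /\
       V = [set s | match s with
                    | KN m => ~ (exists N, F0 N /\ N m)
                    | KU N => ~ F0 (proj1_sig N)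
                    | KInf => True
                    end]
  end.

Definition Kcont (R : realType) (F : set (set nat)) (f : Kpt F -> R) : Prop :=
  forall t (e : R), 0 < e -> exists V, basic_nbhd t V /\
     forall s, V s -> `|f s - f t| < e.

Definition CK (R : realType) (F : set (set nat)) := {f : Kpt F -> R | Kcont f}.

Definition sup_le (R : realType) F (f : CK R F) (c : R) : Prop :=
  forall t, `|proj1_sig f t| <= c.

Definition dual (R : realType) F (phi : CK R F -> R) : Prop :=
  (forall f g h : CK R F, (forall t, proj1_sig h t = proj1_sig f t + proj1_sig g t) ->
      phi h = phi f + phi g) /\
  (forall (a : R) (f h : CK R F), (forall t, proj1_sig h t = a * proj1_sig f t) ->
      phi h = a * phi f) /\
  (exists M : R, forall f c, sup_le f c -> `|phi f| <= M * c).

Definition dual_ball1 (R : realType) F (phi : CK R F -> R) : Prop :=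
  forall f c, sup_le f c -> `|phi f| <= c.

Definition delta (R : realType) F (t : Kpt F) : CK R F -> R := fun f => proj1_sig f t.

Definition l1seq (R : realType) (lam : nat -> R) : Prop :=
  exists M : R, forall m, \sum_(0 <= n < m) `|lam n| <= M.

Definition l1_apply (R : realType) F (lam : nat -> R) : CK R F -> R :=
  fun f => limn (series (fun n => lam n * proj1_sig f (KN n))).

Definition no_l1_seq_wstar_to_delta_inf (R : realType) F : Prop :=
  ~ exists lam : nat -> nat -> R,
      (forall k, l1seq (lam k)) /\
      (forall f : CK R F, (fun k => l1_apply (lam k) f) @ \oo --> delta KInf f).

Definition dual_subspace (R : realType) F (Y : set (CK R F -> R)) : Prop :=
  Y `<=` @dual R F /\ Y (fun _ => 0) /\
  (forall phi psi, Y phi -> Y psi -> Y (fun f => phi f + psi f)) /\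
  (forall (a : R) phi, Y phi -> Y (fun f => a * phi f)).

Definition norm_closed (R : realType) F (Y : set (CK R F -> R)) : Prop :=
  forall (phis : nat -> CK R F -> R) (phi : CK R F -> R),
    (forall k, Y (phis k)) -> dual phi ->
    (forall e : R, 0 < e -> exists N, forall k, (N <= k)%N ->
        forall f c, sup_le f c -> `|phis k f - phi f| <= e * c) ->
    Y phi.

(** |||f||| = sup { phi f : phi in Y, ||phi|| <= 1 } is an equivalent norm:
    ||f|| <= c |||f||| for some c > 0 (|||f||| <= ||f|| always holds). *)
Definition norming (R : realType) F (Y : set (CK R F -> R)) : Prop :=
  exists c : R, 0 < c /\ forall (f : CK R F) (b : R),
    (forall phi, Y phi -> dual_ball1 phi -> phi f <= b) -> sup_le f (c * b).

Definition wstar_open (R : realType) F (U : set (CK R F -> R)) : Prop :=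
  forall phi, U phi -> exists (fs : seq (CK R F)) (e : R), 0 < e /\
    forall psi, dual psi -> (forall f, List.In f fs -> `|psi f - phi f| < e) -> U psi.

Definition wstar_compact (R : realType) F (S : set (CK R F -> R)) : Prop :=
  S `<=` @dual R F /\
  forall (I : Type) (U : I -> set (CK R F -> R)),
    (forall i, wstar_open (U i)) -> S `<=` \bigcup_i U i ->
    exists J : seq I, S `<=` \bigcup_(i in [set i | List.In i J]) U i.

Definition abs_convex (R : realType) F (S : set (CK R F -> R)) : Prop :=
  forall phi psi (a b : R), S phi -> S psi -> `|a| + `|b| <= 1 ->
    S (fun f => a * phi f + b * psi f).

(** Sets defining the Mackey topology mu(Z, Y): absolutely convex w*-compact
    subsets of Y; mu(Z,Y) is given by the seminorms p_S(z) = sup_{phi in S} |phi z|. *)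
Definition mackey_set (R : realType) F (Y S : set (CK R F -> R)) : Prop :=
  S `<=` Y /\ abs_convex S /\ wstar_compact S.

Definition directed (I : Type) (le : I -> I -> Prop) : Prop :=
  inhabited I /\ (forall i, le i i) /\
  (forall i j k, le i j -> le j k -> le i k) /\
  (forall i j, exists k, le i k /\ le j k).

Definition mackey_cauchy (R : realType) F (Y : set (CK R F -> R))
    (I : Type) (le : I -> I -> Prop) (x : I -> CK R F) : Prop :=
  forall S, mackey_set Y S -> forall e : R, 0 < e ->
    exists i0, forall i j, le i0 i -> le i0 j ->
      forall phi, S phi -> `|phi (x i) - phi (x j)| <= e.

Definition mackey_converges (R : realType) F (Y : set (CK R F -> R))
    (I : Type) (le : I -> I -> Prop) (x : I -> CK R F) (z : CK R F) : Prop :=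
  forall S, mackey_set Y S -> forall e : R, 0 < e ->
    exists i0, forall i, le i0 i -> forall phi, S phi -> `|phi (x i) - phi z| <= e.

Definition mackey_complete (R : realType) F (Y : set (CK R F -> R)) : Prop :=
  forall (I : Type) (le : I -> I -> Prop) (x : I -> CK R F),
    directed le -> mackey_cauchy Y le x -> exists z, mackey_converges Y le x z.

Definition fully_mackey_complete (R : realType) F : Prop :=
  forall Y : set (CK R F -> R),
    dual_subspace Y -> norming Y -> norm_closed Y -> mackey_complete Y.

(* Main.v *)
(* Let Y be the norming, norm-closed subspace l1(N) + R delta_oo of the dual of
   C(K_F).  Evaluation at the points of N and the constant function 1 separate
   Y, so a w*-compact subset of Y is w*-sequentially compact.  If no sequence of
   l1(N) is w*-convergent to delta_oo, the linear form on Y that reads off the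
   coefficient of delta_oo is then w*-continuous at 0 on each absolutely convex
   w*-compact set, hence, by a finite-dimensional Hahn-Banach argument, uniformly
   approximable there by elements of C(K_F).  These approximants form a Cauchy net
   for mu(C(K_F), Y); a limit would vanish on N and be 1 at oo.

   F itself is built by recursion along a well-order of the subsets of N with
   countable initial segments, which also code the sequences of l1(N).  At each
   stage a gliding hump yields a set almost disjoint from the countably many
   previous ones, on which the coded sequence does not tend to 0.  Maximality is
   automatic: along an infinite set almost disjoint from every member of F the
   point evaluations would converge to delta_oo. *)

Require Import Defs.
From HB Require Import structures.
From mathcomp Require Import all_boot all_order all_algebra.
From mathcomp Require Import all_classical all_reals all_analysis.
From mathcomp Require Import wochoice.
From mathcomp Require Import zify ring lra.
From Stdlib Require Wellfounded.Inverse_Image.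

Set Implicit Arguments. Unset Strict Implicit. Unset Printing Implicit Defensive.
(* [all_analysis] has its own [sup_le] *)
Import Defs.
Import Order.TTheory GRing.Theory Num.Theory.
Import numFieldNormedType.Exports.
Local Open Scope classical_set_scope.
Local Open Scope ring_scope.

(** * Almost disjoint families under the continuum hypothesis *)

Lemma finite_nat_ltP (A : set nat) :
  finite_set A <-> exists k, forall n, A n -> (n < k)%N.
Proof.
split=> [/finite_seqP[s ->]|[k Ak]]; last first.
  by apply: (@sub_finite_set _ _ `I_k) => // n /Ak.
exists (\max_(x <- s) x).+1 => n /= ns.
exact: (@leq_bigmax_seq _ s xpredT id n ns isT).
Qed.

Lemma infinite_nat_geP (A : set nat) :
  infinite_set A <-> forall k, exists2 n, A n & (k <= n)%N.
Proof.
split=> [Ainf k|Aub /finite_nat_ltP[k Ak]]; last first.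
  by have [n /Ak nk kn] := Aub k; rewrite ltnNge kn in nk.
apply: contrapT => /forall2NP Ak; apply/Ainf/finite_nat_ltP; exists k => n An.
by rewrite ltnNge; apply/negP => kn; have [] := Ak n.
Qed.

(** The negated converse of a reflexive well-ordering: a least inaccessible point would be
    accessible, and two distinct points each below the other would both be least in their pair. *)
Lemma well_order_strict (T : eqType) : exists lt : T -> T -> Prop,
  well_founded lt /\ forall a b, a <> b -> lt a b \/ lt b a.
Proof.
have [R Rwo] := well_ordering_principle T.
exists (fun a b => ~ R b a); split.
  move=> a; apply: contrapT => aN.
  have [|z [[/asboolP zN zmin] _]] := Rwo [pred x | `[< ~ Acc (fun a b => ~ R b a) x >]].
    by exists a; apply/asboolP.
  apply: zN; split=> y Rzy; apply: contrapT => yN.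
  by apply/Rzy/zmin/asboolP.
move=> a b ab; apply: contrapT => /not_orP[/contrapT Rba /contrapT Rab].
have Rxx x : R x x.
  have [|z [[/eqP zx zmin] _]] := Rwo (pred1 x); first by exists x; exact/eqP.
  by rewrite -{1}zx; apply: zmin; exact/eqP.
have [|z [_ zuniq]] := Rwo (pred2 a b); first by exists a; rewrite inE eqxx.
suff [za zb] : z = a /\ z = b by apply: ab; rewrite -za.
split; apply: zuniq; split; rewrite ?inE ?eqxx ?orbT //.
- by move=> x; rewrite !inE => /orP[]/eqP->.
- by move=> x; rewrite !inE => /orP[]/eqP->.
Qed.

(** If some initial segment is uncountable, CH gives the segment below the first such [x] the size
    of the whole power set; pulling the order back along an injection into it leaves only countable
    segments. *)
Lemma CH_well_order : CH -> exists lt : set nat -> set nat -> Prop,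
  [/\ well_founded lt, forall a b, a <> b -> lt a b \/ lt b a
    & forall a, countable [set b | lt b a]].
Proof.
move=> ch; have [lt [ltwf lttot]] := @well_order_strict (set nat).
have [ltc|] := pselect (forall a, countable [set b | lt b a]); first by exists lt.
move=> /existsNP[x0 x0N].
have [x [xN xmin]] : exists x, ~ countable [set b | lt b x] /\
    forall y, lt y x -> countable [set b | lt b y].
  elim/(well_founded_ind ltwf): x0 x0N => x IH xN.
  have [?|/existsNP[y /not_implyP[yx yN]]] :=
    pselect (forall y, lt y x -> countable [set b | lt b y]); first by exists x.
  exact: IH yN.
have [//|] := ch [set b | lt b x]; rewrite card_eq_sym => /card_eqPle[] /pcard_leP[f] _.
have fI : injective f.
  by move=> a b; apply: (@inj _ _ _ f); rewrite inE.
have fx a : lt (f a) x by have := @funS _ _ _ _ f a Logic.I.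
exists (fun a b => lt (f a) (f b)); split.
- exact: Wellfounded.Inverse_Image.wf_inverse_image.
- by move=> a b ab; apply: lttot => /fI.
- move=> a; have /countable_injP[g gI] := xmin _ (fx a).
  apply/countable_injP; exists (g \o f) => b c; rewrite !inE /= => bl cl gbc.
  by apply/fI/gI; rewrite ?inE.
Qed.

(* Dedekind cuts of the entries, packed into one set of naturals. *)
Lemma double_sequence_code (R : realType) :
  exists code : (nat -> nat -> R) -> set nat, injective code.
Proof.
exists (fun lam => [set pickle knq | knq in
   [set knq : nat * nat * rat | ratr knq.2 < lam knq.1.1 knq.1.2]]).
move=> lam mu E; apply/funext => k; apply/funext => n.
have cut (l m : nat -> nat -> R) q :
    [set pickle knq | knq in
       [set knq : nat * nat * rat | ratr knq.2 < l knq.1.1 knq.1.2]] `<=`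
    [set pickle knq | knq in
       [set knq : nat * nat * rat | ratr knq.2 < m knq.1.1 knq.1.2]] ->
    ratr q < l k n -> ratr q < m k n.
  move=> sub lq; have [|knq /=] := sub (pickle (k, n, q)); first by exists (k, n, q).
  by move=> mq /(pcan_inj pickleK) e; move: mq; rewrite e.
apply/eqP; rewrite eq_le; apply/andP; split; rewrite leNgt; apply/negP => h.
  have [q] := rat_in_itvoo h; rewrite in_itv/= => /andP[q1 q2].
  have := cut lam mu q; rewrite E => /(_ (@subset_refl _ _) q2) q3.
  by have := lt_trans q1 q3; rewrite ltxx.
have [q] := rat_in_itvoo h; rewrite in_itv/= => /andP[q1 q2].
have := cut mu lam q; rewrite E => /(_ (@subset_refl _ _) q2) q3.
by have := lt_trans q1 q3; rewrite ltxx.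
Qed.

(** * Gliding hump in l1(N), tested on arbitrary functions on N *)

Definition pairing (R : realType) (lam g : nat -> R) : R :=
  limn (series (fun n => lam n * g n)).

Lemma is_cvg_l1_normed (R : realType) (lam g : nat -> R) (c : R) :
  l1seq lam -> (forall n, `|g n| <= c) ->
  cvgn [normed series (fun n => lam n * g n)].
Proof.
move=> [M lamM] gc; apply: nondecreasing_is_cvgn.
  by apply: nondecreasing_series => n _ _; rewrite normr_ge0.
exists (M * c) => _ [n _ <-] /=.
apply: (@le_trans _ _ (\sum_(0 <= i < n) `|lam i| * c)).
  by apply: ler_sum => i _; rewrite normrM ler_wpM2l.
by rewrite -mulr_suml ler_wpM2r // (le_trans _ (gc 0)).
Qed.

Lemma is_cvg_l1 (R : realType) (lam g : nat -> R) (c : R) :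
  l1seq lam -> (forall n, `|g n| <= c) -> cvgn (series (fun n => lam n * g n)).
Proof. by move=> laml1 gc; apply/normed_cvg/is_cvg_l1_normed. Qed.

Lemma pairing_le (R : realType) (lam g : nat -> R) (M c : R) :
  (forall m, \sum_(0 <= n < m) `|lam n| <= M) -> (forall n, `|g n| <= c) ->
  `|pairing lam g| <= M * c.
Proof.
move=> lamM gc; have laml1 : l1seq lam by exists M.
have ncvg := is_cvg_l1_normed laml1 gc.
apply: (le_trans (lim_series_norm ncvg)); apply: (limr_le ncvg).
apply: nearW => m; rewrite /series /=.
apply: (@le_trans _ _ (\sum_(0 <= i < m) `|lam i| * c)).
  by apply: ler_sum => i _; rewrite normrM ler_wpM2l.
by rewrite -mulr_suml ler_wpM2r // (le_trans _ (gc 0)).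
Qed.

Lemma normr_indic_le1 (R : realType) (T : Type) (A : set T) (x : T) :
  `|\1_A x : R| <= 1.
Proof. by rewrite indicE; case: (x \in A); rewrite ?normr0 ?normr1. Qed.

(** Coordinatewise convergence makes the head up to [m] small for late [k]; for that [k],
    summability makes the tail small beyond a large bound. The middle keeps at least 7/8 - 1/8 -
    1/8. *)
Lemma l1_head_mass_tail (R : realType) (lam : nat -> nat -> R) (U : set nat) (m : nat) :
  (forall k, l1seq (lam k)) -> (forall n, lam ^~ n @ \oo --> (0 : R)) ->
  (fun k => pairing (lam k) \1_U) @ \oo --> (1 : R) ->
  exists kM : nat * nat,
    [/\ (m <= kM.1)%N, (m < kM.2)%N,
        \sum_(0 <= n < m) `|lam kM.1 n| <= 8^-1,
        forall p, \sum_(kM.2 <= n < p) `|lam kM.1 n| <= 8^-1 &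
        2^-1 <= \sum_(m <= n < kM.2) lam kM.1 n * \1_U n].
Proof.
move=> laml1 lam0 lamU.
have head0 : (fun k => \sum_(0 <= n < m) `|lam k n|) @ \oo --> (0 : R).
  elim: m => [|m IH].
    by under eq_fun do rewrite big_geq //; apply: cvg_cst.
  under eq_fun do rewrite big_nat_recr //=.
  have := cvgD IH (cvg_norm (lam0 m)); rewrite normr0 addr0; exact.
have [k [mk hk Uk]] : exists k, [/\ (m <= k)%N, \sum_(0 <= n < m) `|lam k n| <= 8^-1
    & 7 / 8 <= pairing (lam k) \1_U].
  have h1 : \forall k \near \oo, \sum_(0 <= n < m) `|lam k n| <= 8^-1.
    have : 0 < 8^-1 :> R by [].
    move/cvgrPdist_le : head0 => /[apply]; apply: filterS => k.
    by rewrite sub0r normrN ger0_norm // sumr_ge0.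
  have h2 : \forall k \near \oo, 7 / 8 <= pairing (lam k) \1_U.
    have : 0 < 8^-1 :> R by [].
    move/cvgrPdist_le : lamU => /[apply]; apply: filterS => k.
    rewrite ler_norml => /andP[_]; lra.
  near \oo => k; exists k; split; near: k => //.
  exact: nbhs_infty_ge.
have Ucvg := is_cvg_l1 (laml1 k) (normr_indic_le1 R U).
have ncvg : cvgn (series (fun n => `|lam k n|)).
  have one n : `|(cst 1 : nat -> R) n| <= 1 by rewrite normr1.
  have -> : (fun n => `|lam k n|) = (fun n => `|lam k n * cst 1 n|).
    by apply/funext => n; rewrite /cst mulr1.
  exact: is_cvg_l1_normed (laml1 k) one.
have [M [mM tM UM]] : exists M, [/\ (m < M)%N,
    limn (series (fun n => `|lam k n|)) - 8^-1 <= series (fun n => `|lam k n|) M &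
    pairing (lam k) \1_U - 8^-1 <= series (fun n => lam k n * \1_U n) M].
  near \oo => M; exists M; split; near: M.
  - exact: nbhs_infty_gt.
  - have : 0 < 8^-1 :> R by [].
    move/cvgrPdist_le : ncvg => /[apply]; apply: filterS => M.
    rewrite ler_norml => /andP[_]; lra.
  - have : 0 < 8^-1 :> R by [].
    move/cvgrPdist_le : Ucvg => /[apply]; apply: filterS => M.
    rewrite ler_norml => /andP[_]; rewrite /pairing; lra.
exists (k, M); split => //= [p|].
  have [pM|/ltnW Mp] := leqP p M; first by rewrite big_geq.
  have le : series (fun n => `|lam k n|) p <= limn (series (fun n => `|lam k n|)).
    apply: nondecreasing_cvgn_le => //.
    by apply: nondecreasing_series => n _ _; rewrite normr_ge0.
  have e : series (fun n => `|lam k n|) p =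
      series (fun n => `|lam k n|) M + \sum_(M <= n < p) `|lam k n|.
    by rewrite /series /= (big_cat_nat _ Mp).
  lra.
have headU : `|\sum_(0 <= n < m) lam k n * \1_U n| <= \sum_(0 <= n < m) `|lam k n|.
  apply: (le_trans (ler_norm_sum _ _ _)); apply: ler_sum => i _.
  by rewrite normrM ler_piMr // normr_indic_le1.
have e : series (fun n => lam k n * \1_U n) M = \sum_(0 <= n < m) lam k n * \1_U n +
    \sum_(m <= n < M) lam k n * \1_U n.
  by rewrite /series /= (big_cat_nat _ (ltnW mM)).
move: headU; rewrite ler_norml => /andP[h1 h2].
lra.
Unshelve. all: by end_near. Qed.

(** Consecutive blocks [[ms i, ms i.+1)] each carry a hump of some [lam k] off the first [ms i] sets
    [B j]; [A] collects the parts of the blocks off those sets. *)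
Lemma gliding_hump (R : realType) (lam : nat -> nat -> R) (B : nat -> set nat) :
  (forall k, l1seq (lam k)) -> (forall n, lam ^~ n @ \oo --> (0 : R)) ->
  (forall i, (fun k => pairing (lam k) \1_(~` \bigcup_(j in `I_i) B j)) @ \oo -->
     (1 : R)) ->
  exists A : set nat, [/\ infinite_set A, forall j, finite_set (A `&` B j) &
    forall k0, exists2 k, (k0 <= k)%N & 4^-1 <= pairing (lam k) \1_A].
Proof.
move=> laml1 lam0 lamU; pose U i := ~` \bigcup_(j in `I_i) B j.
(* Here [m] is at once the left end of the block, the number of sets to avoid and a lower bound for
   [k]. *)
have /choice[s sP] : forall m, exists kM : nat * nat,
    [/\ (m <= kM.1)%N, (m < kM.2)%N,
        \sum_(0 <= n < m) `|lam kM.1 n| <= 8^-1,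
        forall p, \sum_(kM.2 <= n < p) `|lam kM.1 n| <= 8^-1 &
        2^-1 <= \sum_(m <= n < kM.2) lam kM.1 n * \1_(U m) n].
  by move=> m; apply: (l1_head_mass_tail _ laml1 lam0 (lamU m)).
pose ms i := iter i (fun m => (s m).2) 0%N.
have msS i : ms i.+1 = (s (ms i)).2 by [].
have ms_lt i : (ms i < ms i.+1)%N by rewrite msS; have [] := sP (ms i).
have ms_mono : {homo ms : i j / (i <= j)%N}.
  move=> i j /subnK <-; elim: (j - i)%N => // d IH.
  exact: leq_trans IH (ltnW (ms_lt _)).
have ms_ge i : (i <= ms i)%N.
  by elim: i => // i IH; apply: leq_ltn_trans (ms_lt i).
pose A := [set n | exists i, [/\ (ms i <= n)%N, (n < ms i.+1)%N & U (ms i) n]].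
have AE i n : (ms i <= n)%N -> (n < ms i.+1)%N -> \1_A n = \1_(U (ms i)) n :> R.
  move=> in1 in2; rewrite !indicE; congr (_ %:R); congr nat_of_bool.
  apply/idP/idP; rewrite !inE; last by move=> Un; exists i.
  move=> [j [jn1 jn2 Uj]].
  suff -> : i = j by [].
  apply/eqP; rewrite eqn_leq; apply/andP; split; rewrite leqNgt; apply/negP => ij.
    by have := leq_trans jn2 (leq_trans (ms_mono _ _ ij) in1); rewrite ltnn.
  by have := leq_trans in2 (leq_trans (ms_mono _ _ ij) jn1); rewrite ltnn.
exists A; split.
- apply/infinite_nat_geP => i; apply: contrapT => AN.
  have [_ _ _ _] := sP (ms i); rewrite -msS big_nat_cond big1 ?lerNgt //; first lra.
  move=> n; rewrite andbT => /andP[n1 n2]; rewrite -(AE i) // indicE.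
  have [An|An] := pselect (A n); last by rewrite memNset // mulr0.
  by case: AN; exists n => //; apply: leq_trans n1; apply: ms_ge.
(* A block of index above [j] avoids [B j], so the intersection lies below [ms j.+1]. *)
- move=> j; apply/finite_nat_ltP; exists (ms j.+1) => n [[i [n1 n2 Un]] Bn].
  apply: (leq_trans n2); apply: ms_mono; rewrite ltnS.
  rewrite leqNgt; apply/negP => ji; apply: Un; exists j => //=.
  exact: leq_trans ji (ms_ge i).
(* The hump of at least 1/2 on the block loses at most 1/8 to the head and 1/8 to the tail. *)
- move=> k0; have [k_ge M_gt head tail mass] := sP (ms k0).
  set k := (s (ms k0)).1 in k_ge head tail mass *.
  exists k; first exact: leq_trans (ms_ge _) k_ge.
  apply: (limr_ge (is_cvg_l1 (laml1 k) (normr_indic_le1 R A))).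
  exists (ms k0.+1) => //= p /= Mp; rewrite /series /=.
  rewrite (big_cat_nat _ Mp) //= (big_cat_nat _ (ltnW (ms_lt k0))) //=.
  have -> : \sum_(ms k0 <= i < ms k0.+1) lam k i * \1_A i =
            \sum_(ms k0 <= i < ms k0.+1) lam k i * \1_(U (ms k0)) i.
    by apply: eq_big_nat => n /andP[n1 n2]; rewrite (AE k0).
  have small a b : `|\sum_(a <= n < b) lam k n * \1_A n| <= \sum_(a <= n < b) `|lam k n|.
    apply: (le_trans (ler_norm_sum _ _ _)); apply: ler_sum => i _.
    by rewrite normrM ler_piMr // normr_indic_le1.
  have := small 0%N (ms k0); have := small (ms k0.+1) p; have := tail p.
  rewrite -msS in mass *; rewrite !ler_norml => h1 /andP[h2 h3] /andP[h4 h5]; lra.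
Qed.

(** * Transfinite construction, seeded by the dyadic partition of N *)

Definition dyadic (j : nat) : set nat := [set n | logn 2 n.+1 = j].

Lemma dyadic_infinite (j : nat) : infinite_set (dyadic j).
Proof.
apply/infinite_nat_geP => k; have pow_gt0 : (0 < 2 ^ j)%N by rewrite expn_gt0.
(* The members are the odd multiples of 2 ^ j, minus 1. *)
exists (2 ^ j * k.*2.+1).-1; last by nia.
rewrite /dyadic /= prednK ?muln_gt0 ?pow_gt0 // lognM // pfactorK //.
by rewrite logn_coprime ?addn0 // coprime2n /= odd_double.
Qed.

Lemma dyadic_disjoint (i j : nat) : i <> j -> dyadic i `&` dyadic j = set0.
Proof. by move=> ij; apply/seteqP; split=> // n [ni nj]; apply: ij; rewrite -ni -nj. Qed.

(** Inverts an injection into the naturals, with [x0] at the indices outside its range. *)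
Lemma countable_enum (T : Type) (x0 : T) (A : set T) : countable A -> A x0 ->
  exists B : nat -> T, (forall j, A (B j)) /\ forall x, A x -> exists j, B j = x.
Proof.
move=> /countable_injP[g gI] Ax0.
have /choice[B BP] : forall j, exists x, A x /\
    forall y, A y -> g y = j -> x = y.
  move=> j; have [[x [Ax gx]]|gN] := pselect (exists x, A x /\ g x = j).
    by exists x; split => // y Ay gy; apply: gI; rewrite ?inE // gx gy.
  by exists x0; split => // y Ay gy; case: gN; exists y.
by exists B; split => [j|x Ax]; [have [] := BP j | exists (g x); apply: (BP _).2].
Qed.

Definition recurrent_mass (R : realType) (lam : nat -> nat -> R) (A : set nat) : Prop :=
  forall k0, exists2 k, (k0 <= k)%N & 4^-1 <= pairing (lam k) \1_A.

(** Stage [a] of the recursion handles the sequence coded by [a]; only countably many sets precede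
    it, so the gliding hump applies. *)
Lemma CH_recurrent_mass_family (R : realType) : CH ->
  exists F : set (set nat), [/\ almost_disjoint_family F,
    forall n, exists2 N, F N & N n &
    forall lam : nat -> nat -> R,
      (forall k, l1seq (lam k)) -> (forall n, lam ^~ n @ \oo --> (0 : R)) ->
      (forall F0, finite_set F0 -> F0 `<=` F ->
        (fun k => pairing (lam k) \1_(~` \bigcup_(N in F0) N)) @ \oo --> (1 : R)) ->
      exists2 A, F A & recurrent_mass lam A].
Proof.
move=> /CH_well_order[lt [ltwf lttot ltc]].
have [code codeI] := double_sequence_code R.
(* Sets that code no sequence decode to the zero sequence. *)
pose decode a := xget (fun _ _ => 0) [set lam | code lam = a].
have codeK lam : decode (code lam) = lam.
  by apply: codeI; apply: (@xgetPex _ _ [set l | code l = code lam]); exists lam.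
pose good fam lam A := [/\ infinite_set A,
  forall N, fam N -> finite_set (A `&` N) & @recurrent_mass R lam A].
(* The default [dyadic 0] already belongs to the family, so a stage without a good set adds
   nothing. *)
pose next fam lam := xget (dyadic 0) [set A | good fam lam A].
pose G := Fix ltwf (fun _ => set nat) (fun a rec =>
  next (range dyadic `|` [set N | exists b (ba : lt b a), N = rec b ba]) (decode a)).
pose prev a := range dyadic `|` G @` [set b | lt b a].
have GE a : G a = next (prev a) (decode a).
  rewrite /G Fix_eq -/G => [|x f g fg].
    congr next; congr (_ `|` _); apply/seteqP; split=> [N [b [ba ->]]|_ [b ba <-]].
      by exists b.
    by exists b, ba.
  congr next; congr (_ `|` _); apply/seteqP; split=> N [b [ba ->]]; exists b, ba.
    exact: fg.
  exact/esym/fg.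
have GP a : G a = dyadic 0 \/ good (prev a) (decode a) (G a).
  have [ex|nex] := pselect (exists A, good (prev a) (decode a) A).
    by right; rewrite GE; apply: (@xgetPex _ _ [set A | good _ _ A]).
  by left; rewrite GE; apply: xgetPN => A gA; apply: nex; exists A.
have dydy i j : dyadic i <> dyadic j -> finite_set (dyadic i `&` dyadic j).
  move=> ij; rewrite dyadic_disjoint; first exact: finite_set0.
  by move=> e; apply: ij; rewrite e.
have Gdy a j : G a <> dyadic j -> finite_set (G a `&` dyadic j).
  have [->|[_ Ga _] _] := GP a; first exact: dydy.
  by apply: Ga; left; exists j.
have GG a b : lt b a -> G a <> G b -> finite_set (G a `&` G b).
  move=> ba; have [->|[_ Ga _] _] := GP a.
    by move=> e; rewrite setIC; apply: Gdy => /esym.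
  by apply: Ga; right; exists b.
(* The dyadic classes make [F] infinite and covering. *)
pose F := range dyadic `|` range G.
have F_infinite N : F N -> infinite_set N.
  move=> [[j _ <-]|[a _ <-]]; first exact: dyadic_infinite.
  by have [->|[]] := GP a; first exact: dyadic_infinite.
have F_ad N M : F N -> F M -> N <> M -> finite_set (N `&` M).
  move=> [[i _ <-]|[a _ <-]] [[j _ <-]|[b _ <-]].
  - exact: dydy.
  - by move=> e; rewrite setIC; apply: Gdy => /esym.
  - exact: Gdy.
  - move=> e; have [|ab|ba] := lttot a b; first by move=> ab; rewrite ab in e.
      by rewrite setIC; apply: GG => // /esym.
    exact: GG.
exists F; split.
- split; last by split.
  apply: (@sub_infinite_set _ (range dyadic)); first by move=> N; left.
  suff /card_eqPle[_ /infiniteP] : (range dyadic #= [set: nat])%card by [].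
  apply: inj_card_eq => i j _ _ e; apply: contrapT => /dyadic_disjoint.
  rewrite e setIid => e0.
  by have := @dyadic_infinite j; rewrite e0; apply; exact: finite_set0.
- by move=> n; exists (dyadic (logn 2 n.+1)) => //; left; exists (logn 2 n.+1).
- move=> lam laml1 lam0 lamF; pose a := code lam.
  have prevF : prev a `<=` F.
    by move=> N [?|[b _ <-]]; [left | right; exists b].
  have prev_count : countable (prev a).
    have -> : prev a = \bigcup_(i in [set: bool])
        if i then range dyadic else G @` [set b | lt b a].
      apply/seteqP; split=> [N [?|?]|N [[] _ ?]];
        by [exists true|exists false|left|right].
    apply: bigcup_countable => // -[] _; first exact/(sub_countable (card_image_le _ _)).
    exact/(sub_countable (card_image_le _ _))/ltc.
  have prev0 : prev a (dyadic 0) by left; exists 0%N.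
  have [B [Bprev Bsurj]] := countable_enum prev_count prev0.
  have [|A [Ainf Afin Ahump]] := gliding_hump (B := B) laml1 lam0.
    (* The first [i] sets form a finite subfamily of [F], so the pairing with the complement of
       their union tends to 1. *)
    move=> i; have -> : \bigcup_(j in `I_i) B j = \bigcup_(N in B @` `I_i) N.
      by rewrite bigcup_image.
    apply: lamF; first by apply: finite_image; exact: finite_II.
    by move=> _ [j _ <-]; apply/prevF/Bprev.
  exists (G a); first by right; exists a.
  have : good (prev a) (decode a) (G a).
    rewrite GE; apply: (@xgetPex _ _ [set A | good _ _ A]); exists A.
    by split; rewrite /a ?codeK // => N /Bsurj[j <-].
  by case; rewrite /a codeK.
Qed.

(** * Continuous functions on K_F *)

Lemma basic_nbhdI (F : set (set nat)) (t : Kpt F) (V W : set (Kpt F)) :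
  basic_nbhd t V -> basic_nbhd t W -> exists2 O, basic_nbhd t O & O `<=` V `&` W.
Proof.
case: t => [n|N|] /=.
- by move=> -> ->; exists [set KN n].
- move=> [A [Afin ->]] [B [Bfin ->]].
  exists [set s | s = KU N \/ exists m, s = KN m /\ proj1_sig N m /\ ~ (A `|` B) m].
    by exists (A `|` B); split; rewrite ?finite_setU.
  move=> s [->|[m [-> [Nm /not_orP[Am Bm]]]]]; first by split; left.
  by split; right; exists m.
- move=> [A [Afin [AF ->]]] [B [Bfin [BF ->]]].
  eexists.
    exists (A `|` B); split; first by rewrite finite_setU.
    by split; [move=> N [/AF|/BF] | reflexivity].
  case=> [m|N|] //= mAB; split=> h; apply: mAB.
  + by case: h => N [? ?]; exists N; split => //; left.
  + by case: h => N [? ?]; exists N; split => //; right.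
  + by left.
  + by right.
Qed.

Section continuous_functions.
Variables (R : realType) (F : set (set nat)).
Implicit Types (f g : Kpt F -> R).

Lemma Kcont_locally_constant f :
  (forall t, exists2 V, basic_nbhd t V & forall s, V s -> f s = f t) -> Kcont f.
Proof.
move=> fV t e e0; have [V tV fVt] := fV t; exists V; split => // s /fVt ->.
by rewrite subrr normr0.
Qed.

Lemma Kcont_cst (c : R) : Kcont (fun _ : Kpt F => c).
Proof.
apply: Kcont_locally_constant => -[n|N|] /=; first by exists [set KN n].
  by eexists; [exists set0; split; [exact: finite_set0 | reflexivity]|].
eexists; last by [].
by exists set0; split; [exact: finite_set0 | split; [exact: sub0set | reflexivity]].
Qed.

Lemma Kcont_lin (a : R) f g : Kcont f -> Kcont g -> Kcont (fun t => a * f t + g t).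
Proof.
(* Adding 1 keeps the divisor positive when [a] is 0. *)
move=> fc gc t e e0; have a1 : 0 < `|a| + 1 by rewrite ltr_wpDl.
have e2 : 0 < e / 2 by rewrite divr_gt0.
have [V [tV fV]] := fc t _ (divr_gt0 e2 a1).
have [W [tW gW]] := gc t _ e2.
have [U tU sub] := basic_nbhdI tV tW; exists U; split => // s /sub[/fV fs /gW gs].
have -> : a * f s + g s - (a * f t + g t) = a * (f s - f t) + (g s - g t) by ring.
rewrite (le_lt_trans (ler_normD _ _)) // [e]splitr ler_ltD // normrM.
have : (`|a| + 1) * `|f s - f t| <= e / 2 by rewrite mulrC -ler_pdivlMr // ltW.
by apply: le_trans; rewrite ler_wpM2r // lerDl.
Qed.

Definition CKcst (c : R) : CK R F := exist _ _ (Kcont_cst c).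

Definition CKlin (a : R) (f g : CK R F) : CK R F :=
  exist _ _ (Kcont_lin a (proj2_sig f) (proj2_sig g)).

Definition inf_nbhd (F0 : set (set nat)) : set (Kpt F) :=
  [set s | match s with
           | KN m => ~ (exists N, F0 N /\ N m)
           | KU N => ~ F0 (proj1_sig N)
           | KInf => True
           end].

(** Compactness by hand: [f] is within 1 of its value at [KInf] off finitely many sets [N] with
    their points [KU N], and within 1 of its value at [KU N] on each such [N] off a finite set. *)
Lemma CK_bounded (f : CK R F) : exists c, sup_le f c.
Proof.
case: f => f fc; rewrite /sup_le /=.
have [_ [[F0 [F0fin [F0F ->]]] fV]] := fc KInf 1 ltr01.
(* Monotone bounds over a finite set merge by maxima; this serves for [F0] and for each exceptional
   set [Fin]. *)
have fin_bound (T : Type) (A : set T) (Q : T -> R -> Prop) : finite_set A ->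
    (forall x c d, Q x c -> c <= d -> Q x d) -> (forall x, A x -> exists c, Q x c) ->
    exists c, forall x, A x -> Q x c.
  move=> Afin Qmono.
  have [s As] : exists s : seq {classic T}, A = [set` s] by apply/finite_seqP.
  rewrite As; elim: s {As Afin} => [|x s IH] ex; first by exists 0.
  have [|c cs] := IH; first by move=> y ys; apply: ex; rewrite /= inE ys orbT.
  have [|d dx] := ex x; first by rewrite /= inE eqxx.
  exists (Num.max c d) => y; rewrite /= inE => /predU1P[->|ys].
    by apply: Qmono dx _; rewrite le_max lexx orbT.
  by apply: Qmono (cs _ ys) _; rewrite le_max lexx.
have [||c cP] := @fin_bound _ F0 (fun N c => forall t : Kpt F,
    match t with KN m => N m | KU M => proj1_sig M = N | KInf => False end ->
    `|f t| <= c) F0fin.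
- by move=> N c d h cd t tN; apply: le_trans (h t tN) cd.
- move=> N F0N; have [_ [[Fin [Ffin ->]] fN]] := fc (KU (exist _ N (F0F _ F0N))) 1 ltr01.
  have [||d dP] := @fin_bound _ Fin (fun m c => `|f (KN m)| <= c) Ffin.
  + by move=> m c d; apply: le_trans.
  + by move=> m _; exists `|f (KN m)|.
  exists (Num.max d (`|f (KU (exist _ N (F0F _ F0N)))| + 1)).
  have near_uN s : `|f s - f (KU (exist _ N (F0F _ F0N)))| < 1 ->
      `|f s| <= Num.max d (`|f (KU (exist _ N (F0F _ F0N)))| + 1).
    move=> h; rewrite le_max; apply/orP; right.
    by have := ler_normD (f s - f (KU (exist _ N (F0F _ F0N))))
                         (f (KU (exist _ N (F0F _ F0N)))); rewrite subrK; lra.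
  move=> [m|M|] // tN; last first.
    apply: near_uN; apply: fN; left; congr KU.
    by case: M tN => M FM /= e; subst M; congr exist; exact: Prop_irrelevance.
  have [Fm|Fm] := pselect (Fin m); first by rewrite le_max dP.
  by apply: near_uN; apply: fN; right; exists m.
exists (Num.max c (`|f KInf| + 1)) => t.
have [tV|tV] := pselect (inf_nbhd F0 t).
  rewrite le_max; apply/orP; right; have := fV t tV.
  by have := ler_normD (f t - f KInf) (f KInf); rewrite subrK; lra.
rewrite le_max; apply/orP; left; case: t tV => [m|M|] //=.
  by move=> /contrapT[N [F0N Nm]]; apply: (cP N).
by move=> /contrapT F0M; apply: (cP (proj1_sig M)).
Qed.

Hypothesis Fad : almost_disjoint_family F.

(** The neighbourhood is clopen: for [N] outside [F0], almost disjointness makes the part of [N]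
    covered by [F0] finite, and it is removed at [KU N]. *)
Lemma Kcont_inf_nbhd (F0 : set (set nat)) :
  finite_set F0 -> F0 `<=` F -> Kcont (\1_(inf_nbhd F0) : Kpt F -> R).
Proof.
case: Fad => _ [_ Fdisj] F0fin F0F; apply: Kcont_locally_constant => -[n|[N FN]|].
- by exists [set KN n] => // s ->.
- have [F0N|F0N] := pselect (F0 N).
    eexists; first by exists set0; split; [exact: finite_set0 | reflexivity].
    move=> s [->//|[m [-> /= [Nm _]]]].
    by rewrite !indicE !memNset //= => h; apply: h => //; exists N.
  eexists.
    exists (\bigcup_(M in F0) (N `&` M)); split; last reflexivity.
    apply: bigcup_finite => // M F0M; apply: Fdisj => //; first exact: F0F.
    by move=> e; rewrite e in F0N.
  move=> s [->//|[m [-> /= [Nm mF0]]]].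
  rewrite !indicE !mem_set //= => -[M [F0M Mm]].
  by apply: mF0; exists M.
- exists (inf_nbhd F0); first by exists F0.
  by move=> s Vs; rewrite !indicE !mem_set.
Qed.

(** Basic neighbourhoods of [KInf] omit [n] only through a member of [F] containing it. *)
Lemma Kcont_point (n : nat) (N : set nat) :
  F N -> N n -> Kcont (\1_[set KN n] : Kpt F -> R).
Proof.
move=> FN Nn; apply: Kcont_locally_constant => -[m|M|].
- by exists [set KN m] => // s ->.
- eexists; first by exists [set n]; split; [exact: finite_set1 | reflexivity].
  by move=> s [->//|[m [-> /= [Mm mn]]]]; rewrite !indicE !memNset //= => -[].
- exists (inf_nbhd [set N]).
    by exists [set N]; split; [exact: finite_set1 | split => // _ ->].
  move=> s; rewrite !indicE [KInf \in _]memNset // => sV.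
  rewrite memNset // => e; move: sV; rewrite e /=; apply.
  by exists N.
Qed.

End continuous_functions.

(** * Sequences of l1(N) and the point at infinity; maximality *)

Lemma l1_applyE (R : realType) (F : set (set nat)) (lam g : nat -> R) (f : CK R F) :
  (forall n, proj1_sig f (KN n) = g n) -> l1_apply lam f = pairing lam g.
Proof. by move=> fg; rewrite /l1_apply; under [in series _]eq_fun do rewrite fg. Qed.

Lemma pairing_single (R : realType) (lam g : nat -> R) (n : nat) :
  (forall m, m <> n -> lam m * g m = 0) -> pairing lam g = lam n * g n.
Proof.
move=> z; apply: cvg_lim => //; apply: cvg_near_cst.
exists n.+1 => // p /= np; rewrite /series /=.
rewrite (bigD1_seq n) ?iota_uniq ?mem_index_iota //= big1 ?addr0 //.
by move=> i /eqP; apply: z.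
Qed.

(** Tests on points and on neighbourhoods of [KInf] turn convergence to the evaluation at [KInf]
    into the hypotheses on [lam]; the set [A] so obtained contradicts that convergence. *)
Lemma recurrent_mass_no_l1_seq (R : realType) (F : set (set nat)) :
  almost_disjoint_family F -> (forall n, exists2 N, F N & N n) ->
  (forall lam : nat -> nat -> R,
      (forall k, l1seq (lam k)) -> (forall n, lam ^~ n @ \oo --> (0 : R)) ->
      (forall F0, finite_set F0 -> F0 `<=` F ->
        (fun k => pairing (lam k) \1_(~` \bigcup_(N in F0) N)) @ \oo --> (1 : R)) ->
      exists2 A, F A & recurrent_mass lam A) ->
  no_l1_seq_wstar_to_delta_inf R F.
Proof.
move=> Fad Fcov Fhump [lam [laml1 lamw]].
have indicF0 F0 n : (\1_(@inf_nbhd F F0) (KN n) : R) = \1_(~` \bigcup_(N in F0) N) n.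
  rewrite !indicE; congr (_ %:R); congr nat_of_bool; apply/idP/idP; rewrite !inE /=.
    by move=> h [N F0N Nn]; apply: h; exists N.
  by move=> h [N [F0N Nn]]; apply: h; exists N.
have [A FA Ahump] : exists2 A, F A & recurrent_mass lam A.
  apply: Fhump => // [n|F0 F0fin F0F].
    have [N FN Nn] := Fcov n; pose f : CK R F := exist _ _ (@Kcont_point R F n N FN Nn).
    have -> : lam ^~ n = fun k => l1_apply (lam k) f.
      apply/funext => k; rewrite (@l1_applyE _ _ _ (fun m => (m == n)%:R)); last first.
        move=> m /=; rewrite indicE; congr (_ %:R); congr nat_of_bool.
        by apply/idP/eqP; rewrite inE; [case | move->].
      rewrite (@pairing_single _ _ _ n) ?eqxx ?mulr1 // => m /eqP/negbTE ->.
      by rewrite mulr0.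
    by have := lamw f; rewrite /delta /= indicE memNset.
  pose f : CK R F := exist _ _ (@Kcont_inf_nbhd R F Fad F0 F0fin F0F).
  have -> : (fun k => pairing (lam k) \1_(~` \bigcup_(N in F0) N)) =
            fun k => l1_apply (lam k) f.
    by apply/funext => k; apply/esym/l1_applyE => n; apply: indicF0.
  by have := lamw f; rewrite /delta /= indicE mem_set.
have A1 : [set A] `<=` F by move=> _ ->.
pose g : CK R F := exist _ _ (@Kcont_inf_nbhd R F Fad [set A] (finite_set1 A) A1).
(* The indicator of [A] and its point [KU]. It vanishes at [KInf], yet its pairings are at least 1/4
   infinitely often. *)
pose f := CKlin (-1) g (CKcst F 1).
have := lamw f; rewrite /delta /= indicE mem_set //= mulr1 addNr.
have : 0 < 8^-1 :> R by [].
move=> e0 /cvgrPdist_lt /(_ _ e0) [k0 _ h].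
have [k k0k] := Ahump k0; have := h k k0k.
rewrite (@l1_applyE _ _ _ \1_A) ?sub0r ?normrN => [|n].
  by rewrite ltr_norml => /andP[_]; lra.
rewrite /= indicF0 bigcup_set1 !indicE.
have [An|An] := pselect (A n).
  by rewrite [n \in A]mem_set // memNset ?mulr0 ?add0r // => /(_ An).
by rewrite [n \in A]memNset // mem_set // mulr1 addNr.
Qed.

(** Unit masses at points [x k] of a new set [X], with [k <= x k], eventually leave every finite
    union of members of [F]. *)
Lemma no_l1_seq_maximal (R : realType) (F : set (set nat)) :
  almost_disjoint_family F -> no_l1_seq_wstar_to_delta_inf R F -> maximal_adf F.
Proof.
move=> Fad noseq; split => // G [_ [Ginf Gdisj]] FG.
apply/seteqP; split => // X GX; apply: contrapT => FX; apply: noseq.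
have /infinite_nat_geP Xge := Ginf X GX.
have /choice[x xP] : forall k, exists n, X n /\ (k <= n)%N.
  by move=> k; have [n] := Xge k; exists n.
exists (fun k n => (n == x k)%:R); split => [k|f].
  exists 1 => m; have [xm|xm] := ltnP (x k) m.
    rewrite (bigD1_seq (x k)) ?iota_uniq ?mem_index_iota //= eqxx normr1.
    by rewrite big1 ?addr0 // => i /negbTE->; rewrite normr0.
  rewrite big_nat_cond big1 ?ler01 // => i; rewrite andbT => /= im.
  by rewrite (ltn_eqF (leq_trans im xm)) normr0.
have -> : (fun k => l1_apply (fun n => (n == x k)%:R) f) =
          fun k => proj1_sig f (KN (x k)).
  apply/funext => k; rewrite (@l1_applyE _ _ _ (fun n => proj1_sig f (KN n))) //.
  rewrite (@pairing_single _ _ _ (x k)) ?eqxx ?mul1r // => m /eqP/negbTE->.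
  by rewrite mul0r.
apply/cvgrPdist_lt => e e0.
have [_ [[F0 [F0fin [F0F ->]]] fV]] := proj2_sig f KInf e e0.
have /finite_nat_ltP[k0 k0P] : finite_set (\bigcup_(M in F0) (X `&` M)).
  apply: bigcup_finite => // M F0M; apply: Gdisj => //; first exact/FG/F0F.
  by move=> e1; apply: FX; rewrite e1; apply: F0F.
exists k0 => // k /= k0k; rewrite distrC; apply: fV => -[M [F0M Mx]].
have [Xx kx] := xP k; have : (x k < k0)%N by apply: k0P; exists M.
by rewrite ltnNge (leq_trans k0k kx).
Qed.

(** * The subspace l1(N) + R delta_oo *)

Lemma lim_series_lin (R : realType) (a : R) (u v : nat -> R) :
  cvgn (series u) -> cvgn (series v) ->
  limn (series (fun n => a * u n + v n)) = a * limn (series u) + limn (series v).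
Proof.
move=> uc vc; apply: cvg_lim => //.
have -> : series (fun n => a * u n + v n) = fun m => a * series u m + series v m.
  by apply/funext => m; rewrite /series /= big_split /= -mulr_sumr.
by apply: cvgD vc; apply: cvgM uc; apply: cvg_cst.
Qed.

Lemma pairing_linr (R : realType) (lam f g : nat -> R) (a c d : R) : l1seq lam ->
  (forall n, `|f n| <= c) -> (forall n, `|g n| <= d) ->
  pairing lam (fun n => a * f n + g n) = a * pairing lam f + pairing lam g.
Proof.
move=> laml1 fc gd; rewrite /pairing -lim_series_lin; last 2 first.
- exact: is_cvg_l1 fc.
- exact: is_cvg_l1 gd.
by congr (limn (series _)); apply/funext => n; ring.
Qed.

Lemma pairing_linl (R : realType) (lam mu f : nat -> R) (a c : R) : l1seq lam ->
  l1seq mu -> (forall n, `|f n| <= c) ->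
  pairing (fun n => a * lam n + mu n) f = a * pairing lam f + pairing mu f.
Proof.
move=> laml1 mul1 fc; rewrite /pairing -lim_series_lin; last 2 first.
- exact: is_cvg_l1 fc.
- exact: is_cvg_l1 fc.
by congr (limn (series _)); apply/funext => n; ring.
Qed.

Lemma l1seq_lin (R : realType) (lam mu : nat -> R) (a : R) :
  l1seq lam -> l1seq mu -> l1seq (fun n => a * lam n + mu n).
Proof.
move=> [M lamM] [N muN]; exists (`|a| * M + N) => m.
apply: (@le_trans _ _ (\sum_(0 <= n < m) (`|a| * `|lam n| + `|mu n|))).
  by apply: ler_sum => n _; rewrite -normrM ler_normD.
by rewrite big_split /= -mulr_sumr lerD // ler_wpM2l.
Qed.

Lemma l1seq_single (R : realType) (n : nat) (a : R) :
  l1seq (fun m => a * (m == n)%:R).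
Proof.
exists `|a| => m; have [xm|xm] := ltnP n m.
  rewrite (bigD1_seq n) ?iota_uniq ?mem_index_iota //= eqxx mulr1.
  by rewrite big1 ?addr0 // => i /negbTE->; rewrite mulr0 normr0.
rewrite big_nat_cond big1 // => i; rewrite andbT => /= im.
by rewrite (ltn_eqF (leq_trans im xm)) mulr0 normr0.
Qed.

Lemma l1seq0 (R : realType) : l1seq (fun _ : nat => 0 : R).
Proof. by exists 0 => m; rewrite big1 // => i _; rewrite normr0. Qed.

Lemma pairing0 (R : realType) (f : nat -> R) : pairing (fun _ => 0) f = 0.
Proof. by rewrite (@pairing_single _ _ _ 0%N) ?mul0r // => m _; rewrite mul0r. Qed.

Lemma small_multiple_eq0 (R : realType) (x K : R) :
  (forall e : R, 0 < e -> `|x| <= e * K) -> x = 0.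
Proof.
move=> h; apply/eqP/contraT => x0; have xp : 0 < `|x| by rewrite normr_gt0.
have K0 : 0 < K by have := h _ ltr01; rewrite mul1r; apply: lt_le_trans.
have := h (`|x| / (2 * K)); rewrite divr_gt0 ?mulr_gt0 // => /(_ isT).
have -> : `|x| / (2 * K) * K = `|x| / 2 by field; rewrite gt_eqF.
by lra.
Qed.

(** Bookkeeping for norm closedness: [p] and [o] are the values of the limit functional at f and at
    1, [a] and [a1] those of the l1 part of an approximant, [b] and [b1] those of the l1 part of the
    limit, [c] the coefficient at infinity of the approximant, [t] the value of f there. The errors
    are 1 + 2 + 1 multiples of [e * d]. *)
Lemma perturbation_bound (R : realFieldType) (a b p c t o a1 b1 e d : R) :
  `|a + c * t - p| <= e * d -> `|a1 + c - o| <= e -> `|a - b| <= e * d ->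
  `|a1 - b1| <= e -> `|t| <= d -> `|p - (b + (o - b1) * t)| <= e * (4 * d).
Proof.
move=> h1 h2 h3 h4 td.
have h5 : `|(c - (o - b1)) * t| <= 2 * e * d.
  rewrite normrM ler_pM //; move: h2 h4; rewrite !ler_norml.
  by move=> /andP[? ?] /andP[? ?]; apply/andP; split; lra.
move: h1 h3 h5; rewrite mulrBl !ler_norml.
by move=> /andP[? ?] /andP[? ?] /andP[? ?]; apply/andP; split; lra.
Qed.

Section linear_functionals.
Variables (R : realType) (F : set (set nat)).
Implicit Types (f g h : CK R F) (phi psi : CK R F -> R) (lam : nat -> R).

Lemma dual_lin phi (a : R) f g : dual phi -> phi (CKlin a f g) = a * phi f + phi g.
Proof.
move=> [phiD [phiM _]].
have h0 : forall t, proj1_sig (CKlin a f (CKcst F 0)) t = a * proj1_sig f t.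
  by move=> t /=; rewrite addr0.
by rewrite -(phiM _ _ _ h0); apply: phiD => t /=; rewrite addr0.
Qed.

Lemma linear_dual phi : (forall (a : R) f g h,
    (forall t, proj1_sig h t = a * proj1_sig f t + proj1_sig g t) ->
    phi h = a * phi f + phi g) ->
  (exists M : R, forall f c, sup_le f c -> `|phi f| <= M * c) -> dual phi.
Proof.
move=> lin bd; split; last split => //.
  by move=> f g h fgh; rewrite (lin 1 f g) ?mul1r // => t; rewrite fgh mul1r.
move=> a f h fh; have phi0 : phi (CKcst F 0) = 0.
  have := lin (-1) (CKcst F 0) (CKcst F 0) (CKcst F 0).
  by move=> /= ->; rewrite ?mulN1r ?addNr // => t; rewrite oppr0 addr0.
by rewrite (lin a f (CKcst F 0)) ?phi0 ?addr0 // => t; rewrite fh /= addr0.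
Qed.

Fixpoint CKsum (m : nat) (a : nat -> R) (fs : nat -> CK R F) : CK R F :=
  if m is m'.+1 then CKlin (a m') (fs m') (CKsum m' a fs) else CKcst F 0.

Lemma CKsumE m a fs t :
  proj1_sig (CKsum m a fs) t = \sum_(0 <= i < m) a i * proj1_sig (fs i) t.
Proof.
elim: m => [|m IH]; first by rewrite big_geq.
by rewrite big_nat_recr //= IH addrC.
Qed.

Lemma dual_sum phi m a fs : dual phi ->
  phi (CKsum m a fs) = \sum_(0 <= i < m) a i * phi (fs i).
Proof.
move=> phid; elim: m => [|m IH]; last first.
  by rewrite big_nat_recr //= dual_lin // IH addrC.
rewrite big_geq //; have [_ [phiM _]] := phid.
by rewrite (phiM 0 (CKcst F 0)) ?mul0r // => t; rewrite mul0r.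
Qed.

Lemma CK_bounded_nat f : exists c, forall n, `|proj1_sig f (KN n)| <= c.
Proof. by have [c fc] := CK_bounded f; exists c. Qed.

Definition l1_inf : set (CK R F -> R) := [set phi | exists lam (c : R),
  l1seq lam /\ forall f, phi f = l1_apply lam f + c * proj1_sig f KInf].

Lemma l1_apply_linl lam mu (a : R) f : l1seq lam -> l1seq mu ->
  l1_apply (fun n => a * lam n + mu n) f = a * l1_apply lam f + l1_apply mu f.
Proof.
by move=> laml1 mul1; have [c fc] := CK_bounded_nat f; exact: pairing_linl fc.
Qed.

Lemma l1_inf_lin (a : R) phi psi : l1_inf phi -> l1_inf psi ->
  l1_inf (fun f => a * phi f + psi f).
Proof.
move=> [lam [c [laml1 phiE]]] [mu [d [mul1 psiE]]].
exists (fun n => a * lam n + mu n), (a * c + d); split; first exact: l1seq_lin.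
by move=> f; rewrite phiE psiE l1_apply_linl //; ring.
Qed.

Lemma l1_inf0 : l1_inf (fun _ => 0).
Proof.
exists (fun _ => 0), 0; split; first exact: l1seq0.
by move=> f; rewrite mul0r addr0; exact/esym/pairing0.
Qed.

Lemma l1_inf_sub_dual : l1_inf `<=` @dual R F.
Proof.
move=> phi [lam [c [laml1 phiE]]]; apply: linear_dual => [a f g h hE|].
  have [b fb] := CK_bounded_nat f; have [d gd] := CK_bounded_nat g.
  rewrite !phiE hE.
  rewrite (@l1_applyE _ _ _ (fun n => a * proj1_sig f (KN n) + proj1_sig g (KN n))) //.
  rewrite (pairing_linr _ laml1 fb gd) -/(l1_apply lam f) -/(l1_apply lam g).
  by rewrite /l1_apply /pairing; ring.
have [M lamM] := laml1; exists (M + `|c|) => f d fd; rewrite phiE mulrDl.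
rewrite (le_trans (ler_normD _ _)) // lerD //.
  by apply: (pairing_le lamM) => n; apply: fd.
by rewrite normrM ler_wpM2l.
Qed.

Lemma l1_inf_subspace : dual_subspace l1_inf.
Proof.
split; first exact: l1_inf_sub_dual.
split; first exact: l1_inf0.
split=> [phi psi phiY psiY|a phi phiY].
  have -> : (fun f => phi f + psi f) = fun f => 1 * phi f + psi f.
    by apply/funext => f; rewrite mul1r.
  exact: l1_inf_lin.
have -> : (fun f => a * phi f) = fun f => a * phi f + 0.
  by apply/funext => f; rewrite addr0.
exact: (l1_inf_lin a phiY l1_inf0).
Qed.

Lemma l1_inf_point (n : nat) (a : R) : l1_inf (fun f => a * proj1_sig f (KN n)).
Proof.
exists (fun m => a * (m == n)%:R), 0; split; first exact: l1seq_single.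
move=> f; rewrite mul0r addr0 (@l1_applyE _ _ _ (fun m => proj1_sig f (KN m))) //.
rewrite (@pairing_single _ _ _ n) ?eqxx ?mulr1 // => m /eqP/negbTE ->.
by rewrite mulr0 mul0r.
Qed.

Lemma l1_inf_delta (a : R) : l1_inf (fun f => a * proj1_sig f KInf).
Proof.
exists (fun _ => 0), a; split; first exact: l1seq0.
by move=> f; rewrite [l1_apply _ _]pairing0 add0r.
Qed.

(** Evaluations at points of N and at [KInf] lie in the unit ball, and the value at [KU N] is
    approached by values along [N]. *)
Lemma l1_inf_norming : almost_disjoint_family F -> norming l1_inf.
Proof.
move=> [_ [Finf _]]; exists 1; split => // f b fb t; rewrite mul1r.
have ball (s : Kpt F) (a : R) : a = 1 \/ a = -1 ->
    dual_ball1 (fun g => a * proj1_sig g s).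
  by move=> a1 g c /(_ s); case: a1 => ->; rewrite ?mulN1r ?mul1r ?normrN.
have fN n : `|proj1_sig f (KN n)| <= b.
  rewrite ler_norml lerNl -mulN1r -{2}[proj1_sig f _]mul1r; apply/andP; split.
    by apply: (fb _ (l1_inf_point n (-1))); apply: ball; right.
  by apply: (fb _ (l1_inf_point n 1)); apply: ball; left.
case: t => [n|N|]; first exact: fN.
  rewrite leNgt; apply/negP; rewrite -subr_gt0 => e0.
  have [_ [[Fin [Ffin ->]] fV]] := proj2_sig f (KU N) _ e0.
  have [k Fk] := (finite_nat_ltP Fin).1 Ffin.
  have [n Nn kn] := (infinite_nat_geP (proj1_sig N)).1 (Finf _ (proj2_sig N)) k.
  have Fn : ~ Fin n by move=> /Fk; rewrite ltnNge kn.
  have := fV (KN n) (or_intror (ex_intro _ n (conj erefl (conj Nn Fn)))).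
  have := ler_normD (proj1_sig f (KN n)) (proj1_sig f (KU N) - proj1_sig f (KN n)).
  by rewrite subrKC distrC; have := fN n; lra.
rewrite ler_norml lerNl -mulN1r -{2}[proj1_sig f _]mul1r; apply/andP; split.
  by apply: (fb _ (l1_inf_delta (-1))); apply: ball; right.
by apply: (fb _ (l1_inf_delta 1)); apply: ball; left.
Qed.

(** The point indicators are parameters, supplied once [F] is known to cover N. *)
Variable pt : nat -> CK R F.
Hypothesis ptE : forall n t, proj1_sig (pt n) t = \1_[set KN n] t.

Lemma pt_KN n m : proj1_sig (pt n) (KN m) = (m == n)%:R.
Proof.
rewrite ptE indicE; congr (_ %:R); congr nat_of_bool.
by apply/idP/eqP; rewrite inE; [case | move->].
Qed.

Lemma pt_KInf n : proj1_sig (pt n) KInf = 0.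
Proof. by rewrite ptE indicE memNset. Qed.

Lemma l1_apply_pt lam n : l1_apply lam (pt n) = lam n.
Proof.
rewrite (@l1_applyE _ _ _ (fun m => (m == n)%:R)); last exact: pt_KN.
rewrite (@pairing_single _ _ _ n) ?eqxx ?mulr1 // => m /eqP/negbTE ->.
by rewrite mulr0.
Qed.

(** The point indicators read off [lam], and then the constant 1 reads off [c]. *)
Lemma l1_inf_separated phi : l1_inf phi -> (forall n, phi (pt n) = 0) ->
  phi (CKcst F 1) = 0 -> forall f, phi f = 0.
Proof.
move=> [lam [c [laml1 phiE]]] phi0 phi1 f.
have lam0 : lam = fun _ => 0.
  by apply/funext => n; have := phi0 n; rewrite phiE pt_KInf mulr0 addr0 l1_apply_pt.
move: phi1; rewrite !phiE lam0 ![l1_apply _ _]pairing0 !add0r /= mulr1 => ->.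
by rewrite mul0r.
Qed.

(** The sum is the value of [phi] at a finitely supported function, the signs of [nu], of sup norm
    at most 1. *)
Lemma l1_norm_le (nu : nat -> R) (e : R) phi : dual phi ->
  (forall n, phi (pt n) = nu n) -> (forall f, sup_le f 1 -> `|phi f| <= e) ->
  forall m, \sum_(0 <= n < m) `|nu n| <= e.
Proof.
move=> phid nuE phie m; pose g := CKsum m (fun n => Num.sg (nu n)) pt.
have -> : \sum_(0 <= n < m) `|nu n| = phi g.
  rewrite dual_sum //; apply: eq_bigr => n _; rewrite nuE.
  by rewrite normrEsg.
apply: le_trans (ler_norm _) _; apply: phie => t; rewrite CKsumE.
have [[n ->]|tN] := pselect (exists n, t = KN n); last first.
  rewrite big1 ?normr0 // => n _; rewrite ptE indicE memNset ?mulr0 //.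
  by move=> /= e1; apply: tN; exists n.
have sg1 : `|Num.sg (nu n)| <= 1 by rewrite normr_sg; case: (_ != 0).
have [nm|nm] := ltnP n m.
  rewrite (bigD1_seq n) ?iota_uniq ?mem_index_iota //= pt_KN eqxx mulr1.
  rewrite big1 ?addr0 // => i; rewrite eq_sym pt_KN => /negbTE->.
  by rewrite mulr0.
rewrite big_nat_cond big1 ?normr0 // => i; rewrite andbT pt_KN => /= im.
by rewrite eq_sym (ltn_eqF (leq_trans im nm)) mulr0.
Qed.

(** An approximant within [e] of [phi] has its l1 part within [e], in l1 norm, of the coordinates
    [phi (pt n)], which are therefore summable. *)
Lemma l1_inf_closed : norm_closed l1_inf.
Proof.
move=> phis phi phisY phid phis_phi.
pose mu n := phi (pt n); pose one := CKcst F (1 : R).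
have approx (e : R) : 0 < e -> exists (k : nat) (lam : nat -> R) (c : R), [/\ l1seq lam,
    forall f, phis k f = l1_apply lam f + c * proj1_sig f KInf,
    forall f d, sup_le f d -> `|phis k f - phi f| <= e * d &
    forall m, \sum_(0 <= n < m) `|lam n - mu n| <= e].
  move=> /phis_phi[k kP]; have {}kP := kP k (leqnn k).
  have [lam [c [laml1 phiE]]] := phisY k; exists k, lam, c; split => //.
  apply: (@l1_norm_le _ _ (fun f => -1 * phi f + phis k f)).
  - have [dD [dM [M dB]]] := phid; have kd := l1_inf_sub_dual (phisY k).
    apply: linear_dual => [a f g h hE|].
      have hlin psi : dual psi -> psi h = a * psi f + psi g.
        move=> psid; rewrite -dual_lin //; case: psid => _ [psiM _].
        rewrite (psiM 1 (CKlin a f g) h) ?mul1r // => t /=; rewrite hE mul1r //.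
      by rewrite !hlin //; ring.
    have [_ [_ [N kB]]] := kd; exists (M + N) => f d fd.
    rewrite mulrDl mulN1r (le_trans (ler_normD _ _)) // normrN lerD //.
      exact: dB.
    exact: kB.
  - by move=> n; rewrite phiE pt_KInf mulr0 addr0 l1_apply_pt /mu; ring.
  - by move=> f f1; rewrite mulN1r addrC; have := kP f 1 f1; rewrite mulr1.
have mul1 : l1seq mu.
  have [k [lam [c [[M lamM] _ _ diff]]]] := approx 1 ltr01.
  exists (M + 1) => m; apply: le_trans (lerD (lamM m) (diff m)).
  rewrite -big_split /=; apply: ler_sum => n _.
  by have := ler_normD (lam n) (mu n - lam n); rewrite subrKC distrC.
(* The coefficient at [KInf] is what the value at 1 leaves beyond the l1 part. *)
exists mu, (phi one - pairing mu (fun _ => 1)); split => // f.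
have [d fd] := CK_bounded f.
apply/eqP; rewrite -subr_eq0; apply/eqP; apply: (@small_multiple_eq0 _ _ (4 * d)) => e e0.
have [k [lam [c [laml1 kE kphi diff]]]] := approx e e0.
have one1 : sup_le one 1 by move=> t; rewrite normr1.
have diffl1 (u : nat -> R) (b : R) :
    (forall n, `|u n| <= b) -> `|pairing lam u - pairing mu u| <= e * b.
  move=> ub; have := pairing_le diff ub.
  have -> : (fun n => lam n - mu n) = fun n => -1 * mu n + lam n.
    by apply/funext => n; rewrite mulN1r addrC.
  by rewrite (pairing_linl _ mul1 laml1 ub) mulN1r addrC.
apply: (@perturbation_bound _ (l1_apply lam f) _ _ c _ _ (pairing lam (fun _ => 1))).
- by rewrite -kE; apply: kphi.
- by have := kphi one 1 one1; rewrite kE /= !mulr1.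
- by apply: diffl1 => n; apply: fd.
- by have := diffl1 (fun _ => 1) 1; rewrite mulr1; apply=> n; rewrite normr1.
- exact: fd.
Qed.

End linear_functionals.

(** * Subsequences, finite lists and finite-dimensional Hahn-Banach *)

Lemma cvg_reindex (R : realType) (u : nat -> R) (l : R) (g : nat -> nat) :
  (forall k, (k <= g k)%N) -> u @ \oo --> l -> (fun k => u (g k)) @ \oo --> l.
Proof.
move=> gk /cvgrPdist_lt ul; apply/cvgrPdist_lt => e /ul[k0 _ h].
by exists k0 => // k /= k0k; apply/h/(leq_trans k0k).
Qed.

Lemma In_map_mem (T : eqType) (U : Type) (x : T -> U) (i : T) (s : seq T) :
  i \in s -> List.In (x i) (map x s).
Proof.
by elim: s => //= j s IH; rewrite inE => /predU1P[->|/IH]; [left | right].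
Qed.

Lemma In_leq_max (j : nat) (J : seq nat) : List.In j J -> (j <= \max_(i <- J) i)%N.
Proof.
elim: J => //= i J IH; rewrite big_cons => -[->|/IH]; first exact: leq_maxl.
by move=> h; rewrite leq_max h orbT.
Qed.

(* Hahn-Banach for the sum of a seminorm [t] and the seminorm [A * sum |x i|]
   of finitely many functionals.  The cone [T] records the values [a], [x], [t]
   on the vectors of the underlying space, and one functional is split off at a
   time. *)
Lemma Hahn_Banach_finite (R : realType) (A : R) (m : nat)
    (T : R -> (nat -> R) -> R -> Prop) :
  0 <= A ->
  (forall a b x y t s, T a x t -> T b y s -> T (a + b) (fun i => x i + y i) (t + s)) ->
  (forall l a x t, T a x t -> T (l * a) (fun i => l * x i) (`|l| * t)) ->
  (forall a x t, T a x t -> `|a| <= t + A * \sum_(0 <= i < m) `|x i|) ->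
  exists c : nat -> R, forall a x t, T a x t -> `|a - \sum_(0 <= i < m) c i * x i| <= t.
Proof.
move=> A0; elim: m T => [|m IH] T TD TZ Tle.
  exists (fun _ => 0) => a x t /Tle.
  by rewrite !big_geq // mulr0 addr0 subr0.
pose q (x : nat -> R) (t : R) := t + A * \sum_(0 <= i < m) `|x i|.
have qD x y t s : q (fun i => x i + y i) (t + s) <= q x t + q y s.
  rewrite /q addrACA lerD2l -mulrDr -big_split /= ler_wpM2l //.
  by apply: ler_sum => i _; apply: ler_normD.
have qZ l x t : q (fun i => l * x i) (`|l| * t) = `|l| * q x t.
  have e : \sum_(0 <= i < m) `|l * x i| = `|l| * \sum_(0 <= i < m) `|x i|.
    by rewrite mulr_sumr; apply: eq_bigr => i _; rewrite normrM.
  by rewrite /q e; ring.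
have Tq a x t : T a x t -> x m = 0 -> `|a| <= q x t.
  by move=> /Tle; rewrite big_nat_recr //= => h xm; rewrite xm normr0 addr0 in h.
(* The coefficient of the last coordinate must lie above [a - q x t] where [x m] is 1 and below
   [q x t - a] where [x m] is -1. *)
pose X := [set r : R | exists a x t, [/\ T a x t, x m = 1 & r = a - q x t]].
have Xub a x t : T a x t -> x m = -1 -> ubound X (q x t - a).
  move=> Taxt xm r [b [y [s [Tbys ym ->]]]].
  have := Tq _ _ _ (TD _ _ _ _ _ _ Taxt Tbys); rewrite xm ym addNr => /(_ erefl).
  by move=> /(le_trans (ler_norm _)); have := qD x y t s; lra.
have Xne a x t : T a x t -> x m = -1 -> X !=set0.
  move=> Taxt xm; exists (-1 * a - q (fun i => -1 * x i) (`|-1| * t)).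
  exists (-1 * a), (fun i => -1 * x i), (`|-1| * t); split => //; first exact: TZ.
  by rewrite xm mulN1r opprK.
have Xne' a x t : T a x t -> x m = 1 -> exists b y s, T b y s /\ y m = -1.
  move=> Taxt xm; exists (-1 * a), (fun i => -1 * x i), (`|-1| * t).
  by split; [exact: TZ | rewrite xm mulr1].
pose c := sup X.
(* Rescaling makes [x m] equal to 1 or -1; where it is 0, [Tq] applies. *)
have side a x t : T a x t -> a - c * x m <= q x t.
  move=> Taxt; case: (ltrgtP (x m) 0) => xm.
  - have x0 : 0 < - x m by rewrite oppr_gt0.
    have nx : `|(- x m)^-1| = (- x m)^-1 by rewrite gtr0_norm // invr_gt0.
    have Ts := TZ (- x m)^-1 _ _ _ Taxt.
    have sm : (- x m)^-1 * x m = -1 by field; rewrite lt_eqF.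
    have : c <= q (fun i => (- x m)^-1 * x i) (`|(- x m)^-1| * t) - (- x m)^-1 * a.
      by apply: ge_sup; [exact: Xne Ts sm | exact: Xub].
    rewrite qZ nx -mulrBr ler_pdivlMl // => h.
    by move: h; rewrite mulNr mulrC; lra.
  - have nx : `|(x m)^-1| = (x m)^-1 by rewrite gtr0_norm // invr_gt0.
    have Ts := TZ (x m)^-1 _ _ _ Taxt.
    have sm : (x m)^-1 * x m = 1 by rewrite mulVf // gt_eqF.
    have [b [y [s [Tb ym]]]] := Xne' _ _ _ Ts sm.
    have : (x m)^-1 * a - q (fun i => (x m)^-1 * x i) (`|(x m)^-1| * t) <= c.
      apply: ub_le_sup; first by eexists; apply: Xub Tb ym.
      by exists ((x m)^-1 * a), (fun i => (x m)^-1 * x i), (`|(x m)^-1| * t).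
    rewrite qZ nx -mulrBr ler_pdivrMl // => h.
    by move: h; rewrite mulrC; lra.
  - rewrite xm mulr0 subr0; apply: le_trans (ler_norm _) _; exact: Tq.
(* Subtracting the last coordinate leaves a cone over the first [m] functionals, dominated by
   [q]. *)
have [|||c' c'P] := IH (fun a x t => exists2 a0, T a0 x t & a = a0 - c * x m).
- move=> a b x y t s [a0 Ta ->] [b0 Tb ->]; exists (a0 + b0); first exact: TD.
  by ring.
- by move=> l a x t [a0 Ta ->]; exists (l * a0); [exact: TZ | ring].
- move=> _ x t [a Ta ->]; rewrite ler_norml lerNl; apply/andP; split; last exact: side.
  have := side _ _ _ (TZ (-1) _ _ _ Ta); rewrite qZ normrN1 mul1r.
  by apply: le_trans; rewrite le_eqVlt; apply/orP; left; apply/eqP; ring.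
exists (fun i => if i == m then c else c' i) => a x t Ta.
rewrite big_nat_recr //= eqxx.
have -> : \sum_(0 <= i < m) (if i == m then c else c' i) * x i =
          \sum_(0 <= i < m) c' i * x i.
  by apply: eq_big_nat => i /andP[_ im]; rewrite ltn_eqF.
have -> : a - (\sum_(0 <= i < m) c' i * x i + c * x m) =
          (a - c * x m) - \sum_(0 <= i < m) c' i * x i by ring.
by apply: c'P; exists a.
Qed.

(** * Sequential w*-compactness *)

Section weak_star_compactness.
Variables (R : realType) (F : set (set nat)).
Implicit Types (f : CK R F) (phi psi : CK R F -> R) (S : set (CK R F -> R)).

(** Without a cluster point in [S], the open sets [U K] of functionals having a neighbourhood missed
    from [K] on would cover [S]; a finite subcover fails at the term of its largest index. *)
Lemma wstar_cluster S (s : nat -> CK R F -> R) :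
  wstar_compact S -> (forall k, S (s k)) ->
  exists l, S l /\ forall (fs : seq (CK R F)) (e : R) K, 0 < e ->
    exists2 k, (K <= k)%N & forall f, List.In f fs -> `|s k f - l f| < e.
Proof.
move=> [_ Scomp] Ss.
pose U (K : nat) : set (CK R F -> R) := [set psi | exists (fs : seq (CK R F)) (e : R),
  0 < e /\ forall k, (K <= k)%N -> ~ forall f, List.In f fs -> `|s k f - psi f| < e].
have Uopen K : wstar_open (U K).
  move=> psi [fs [e [e0 far]]]; have e2 : 0 < e / 2 by rewrite divr_gt0.
  exists fs, (e / 2); split => // psi' _ near; exists fs, (e / 2); split => // k Kk close.
  apply: (far k Kk) => f ffs; have := near f ffs; have := close f ffs.
  by rewrite !ltr_norml => /andP[? ?] /andP[? ?]; apply/andP; split; lra.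
apply: contrapT => nocluster.
have [|J JS] := Scomp nat U Uopen.
  move=> l Sl; apply: contrapT => lU; apply: nocluster; exists l; split => // fs e K e0.
  apply: contrapT => nok; apply: lU; exists K => //; exists fs, e; split => // k Kk close.
  by apply: nok; exists k.
have [j /= jJ [fs [e [e0 far]]]] := JS _ (Ss (\max_(i <- J) i)).
by apply: (far _ (In_leq_max jJ)) => f _; rewrite subrr normr0.
Qed.

(** Covers are pulled back to the compact interval [-1, 1]. Such segments later allow Mackey
    convergence to be read at a single functional. *)
Lemma segment_wstar_compact psi : dual psi ->
  wstar_compact [set phi | exists2 a : R, `|a| <= 1 & phi = fun f => a * psi f].
Proof.
move=> psid; have dualZ (a : R) : dual (fun f => a * psi f).
  have [_ [psiM [M psiB]]] := psid; apply: linear_dual => [b f g h hE|].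
    have -> : psi h = b * psi f + psi g.
      rewrite -dual_lin // (psiM 1 (CKlin b f g) h) ?mul1r // => t /=.
      by rewrite hE mul1r.
    by ring.
  exists (`|a| * M) => f c fc; rewrite normrM -mulrA ler_wpM2l //; exact: psiB.
split=> [_ [a _ ->]|I U Uopen cover]; first exact: dualZ.
pose D (i : {classic I}) := [set a : R | U i (fun f => a * psi f)].
have Dopen i : open (D i).
  rewrite openE => a Da; have [fs [e [e0 near]]] := Uopen i _ Da.
  pose K := \sum_(f <- fs) `|psi f|; have K0 : 0 <= K by apply: sumr_ge0.
  have K1 : 0 < K + 1 by rewrite ltr_wpDl.
  have fK f : List.In f fs -> `|psi f| <= K.
    rewrite /K; elim: (fs) => //= g gs IH; rewrite big_cons => -[->|/IH h].
      by rewrite lerDl sumr_ge0.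
    by rewrite (le_trans h) // lerDr.
  apply/nbhs_ballP; exists (e / (K + 1)); first by rewrite /= divr_gt0.
  move=> b; rewrite /ball /= => ab; apply: near => // f ffs.
  rewrite -mulrBl normrM distrC.
  apply: (@le_lt_trans _ _ (`|a - b| * K)); first by rewrite ler_wpM2l // fK.
  apply: (@le_lt_trans _ _ (`|a - b| * (K + 1))).
    by rewrite ler_wpM2l // lerDl.
  by rewrite -ltr_pdivlMr.
have := @segment_compact R (-1) 1; rewrite compact_cover.
move=> /(_ {classic I} setT D)[//||J _ JD].
  move=> a; rewrite /= in_itv /= -ler_norml => a1.
  by have [|i _ Ui] := cover (fun f => a * psi f); [exists a | exists i].
exists (finmap.enum_fset J) => _ [a a1 ->].
have [|i iJ Di] := JD a; first by rewrite /= in_itv /= -ler_norml.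
exists i => //=; move: iJ; rewrite /= => iJ.
by have := @In_map_mem {classic I} I id i _ iJ; rewrite map_id.
Qed.

Variable pt : nat -> CK R F.
Hypothesis ptE : forall n t, proj1_sig (pt n) t = \1_[set KN n] t.

(** A countable family separating [l1_inf]: the constant 1 at index 0, then the point indicators. *)
Let test (i : nat) : CK R F := if i is n.+1 then pt n else CKcst F 1.

Lemma l1_inf_eq phi psi : l1_inf phi -> l1_inf psi ->
  (forall i, phi (test i) = psi (test i)) -> phi = psi.
Proof.
move=> phiY psiY e; apply/funext => f.
suff : -1 * phi f + psi f = 0 by rewrite mulN1r addrC => /eqP; rewrite subr_eq0 => /eqP.
apply: (l1_inf_separated ptE (l1_inf_lin (-1) phiY psiY)).
  by move=> n; rewrite (e n.+1) /= mulN1r addNr.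
by rewrite (e 0%N) /= mulN1r addNr.
Qed.

(** Otherwise a subsequence stays [e] away from [l] at [f]; its cluster point agrees with [l] on
    every test, hence equals [l]. *)
Lemma wstar_compact_cvg S (s : nat -> CK R F -> R) l :
  S `<=` @l1_inf R F -> wstar_compact S -> (forall k, S (s k)) -> S l ->
  (forall i, (fun k => s k (test i)) @ \oo --> l (test i)) ->
  forall f, (fun k => s k f) @ \oo --> l f.
Proof.
move=> SY Scomp Ss Sl stest f; apply: contrapT => /cvgrPdist_lt ncvg.
have [e [e0 far]] : exists e : R, 0 < e /\
    forall K, exists k, (K <= k)%N /\ e <= `|l f - s k f|.
  apply: contrapT => h; apply: ncvg => e e0; apply: contrapT => h'.
  apply: h; exists e; split => // K; apply: contrapT => h''; apply: h'.
  exists K => // k /= Kk; rewrite ltNge; apply/negP => ek.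
  by apply: h''; exists k.
have [g gP] := choice far.
have [l' [Sl' l'P]] := wstar_cluster Scomp (fun k => Ss (g k)).
have ll' : l' = l.
  apply: l1_inf_eq (SY _ Sl') (SY _ Sl) _ => i.
  apply/eqP; rewrite -subr_eq0; apply/eqP.
  apply: (@small_multiple_eq0 _ _ 2) => d d0.
  have /cvgrPdist_lt/(_ d d0)[K _ KP] := stest i.
  have [k Kk /(_ (test i) (or_introl erefl)) h1] := l'P [:: test i] d K d0.
  have h2 := KP (g k) (leq_trans Kk (gP k).1).
  move: h1 h2; rewrite /= !ltr_norml ler_norml.
  by move=> /andP[? ?] /andP[? ?]; apply/andP; split; lra.
have [k _ /(_ f (or_introl erefl))] := l'P [:: f] e 0%N e0.
by rewrite ll' distrC ltNge (gP k).2.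
Qed.

(** Extraction asks only for [k <= g k], which preserves limits and is stable under composition. *)
Definition seq_compact S := forall s : nat -> CK R F -> R, (forall k, S (s k)) ->
  exists (g : nat -> nat) (l : CK R F -> R), [/\ forall k, (k <= g k)%N, S l &
    forall f, (fun k => s (g k) f) @ \oo --> l f].

(** Diagonal choice: [s (g k)] is within [k.+1%:R^-1] of a cluster point on the first [k] tests. *)
Lemma wstar_seq_compact S : S `<=` @l1_inf R F -> wstar_compact S -> seq_compact S.
Proof.
move=> SY Scomp s Ss; have [l [Sl lP]] := wstar_cluster Scomp Ss.
have /choice[g gP] : forall k, exists n, (k <= n)%N /\
    forall i, (i < k)%N -> `|s n (test i) - l (test i)| < k.+1%:R^-1.
  move=> k; have [|n kn nP] := lP (map test (iota 0 k)) k.+1%:R^-1 k.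
    by rewrite invr_gt0.
  by exists n; split => // i ik; apply/nP/In_map_mem; rewrite mem_iota.
exists g, l; split => //; first by move=> k; have [] := gP k.
apply: wstar_compact_cvg SY Scomp _ Sl _ => [k|i]; first exact: Ss.
apply/cvgrPdist_lt => e e0.
near=> k; rewrite distrC; apply: lt_trans ((gP k).2 i _) _; near: k.
  exact: nbhs_infty_gt.
exact: (near_infty_natSinv_lt (PosNum e0)).
Unshelve. all: by end_near. Qed.

End weak_star_compactness.

(** * Failure of Mackey completeness *)

Section mackey_incompleteness.
Variables (R : realType) (F : set (set nat)).
Implicit Types (f : CK R F) (phi psi : CK R F -> R) (S : set (CK R F -> R)).
Variable pt : nat -> CK R F.
Hypothesis ptE : forall n t, proj1_sig (pt n) t = \1_[set KN n] t.

Let test (i : nat) : CK R F := if i is n.+1 then pt n else CKcst F 1.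

(** On [l1_inf], the coefficient of the evaluation at [KInf], computed from [phi] alone: its value
    at 1 minus the sum of its l1 part. *)
Definition inf_coef phi : R := phi (CKcst F 1) - limn (series (fun n => phi (pt n))).

Lemma inf_coefE phi lam (c : R) : l1seq lam ->
  (forall f, phi f = l1_apply lam f + c * proj1_sig f KInf) -> inf_coef phi = c.
Proof.
move=> laml1 phiE; rewrite /inf_coef phiE /= mulr1.
have -> : (fun n => phi (pt n)) = lam.
  by apply/funext => n; rewrite phiE (pt_KInf ptE) mulr0 addr0 (l1_apply_pt ptE).
rewrite (@l1_applyE _ _ _ (fun _ => 1)) // /pairing.
by under [X in limn (series X)]eq_fun do rewrite mulr1; ring.
Qed.

Lemma inf_coef_lin (a : R) phi psi : l1_inf phi -> l1_inf psi ->
  inf_coef (fun f => a * phi f + psi f) = a * inf_coef phi + inf_coef psi.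
Proof.
move=> [lam [c [laml1 phiE]]] [mu [d [mul1 psiE]]].
rewrite (inf_coefE laml1 phiE) (inf_coefE mul1 psiE).
apply: (inf_coefE (l1seq_lin a laml1 mul1)) => f.
by rewrite phiE psiE l1_apply_linl //; ring.
Qed.

Lemma inf_coefZ (a : R) phi : l1_inf phi ->
  inf_coef (fun f => a * phi f) = a * inf_coef phi.
Proof.
move=> phiY; have := inf_coef_lin a phiY (@l1_inf0 R F).
have -> : (fun f => a * phi f + 0) = fun f => a * phi f.
  by apply/funext => f; rewrite addr0.
move=> ->; rewrite [inf_coef (fun _ => 0)](inf_coefE (@l1seq0 R) (c := 0)) ?addr0 // => f.
by rewrite [l1_apply _ _]pairing0 mul0r addr0.
Qed.

(* Sequential compactness passes to sums by extracting subsequences; the sums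
   make the index set of the net below directed. *)
Definition seq_mackey_set S :=
  [/\ S `<=` @l1_inf R F, abs_convex S, S !=set0 & seq_compact S].

Lemma abs_convexZ S (a : R) phi : abs_convex S -> `|a| <= 1 -> S phi ->
  S (fun f => a * phi f).
Proof.
move=> Sac a1 Sphi; have := Sac phi phi a 0 Sphi Sphi.
rewrite normr0 addr0 => /(_ a1); congr S; apply/funext => f.
by rewrite mul0r addr0.
Qed.

Lemma abs_convex0 S : abs_convex S -> S !=set0 -> S (fun _ => 0).
Proof.
move=> Sac [phi Sphi]; have := @abs_convexZ _ 0 _ Sac _ Sphi.
by rewrite normr0 ler01 => /(_ isT); congr S; apply/funext => f; rewrite mul0r.
Qed.

Lemma seq_mackey_singleton0 : seq_mackey_set [set fun _ => 0].
Proof.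
split=> [_ ->|_ _ a b -> -> _||s s0].
- exact: l1_inf0.
- by apply/funext => f; rewrite !mulr0 addr0.
- by exists (fun _ => 0).
- exists id, (fun _ => 0); split => // f.
  have -> : (fun k => s (id k) f) = fun _ => 0 by apply/funext => k; rewrite s0.
  exact: cvg_cst.
Qed.

Lemma mackey_seq_mackey S : mackey_set (@l1_inf R F) S -> S !=set0 -> seq_mackey_set S.
Proof.
move=> [SY [Sac Scomp]] Sne; split => //.
exact: (wstar_seq_compact ptE SY Scomp).
Qed.

Lemma seq_mackey_sum S T : seq_mackey_set S -> seq_mackey_set T ->
  seq_mackey_set [set phi | exists s t, [/\ S s, T t & phi = fun f => s f + t f]].
Proof.
move=> [SY Sac Sne Ssc] [TY Tac Tne Tsc]; split.
- move=> _ [s [t [/SY sY /TY tY ->]]].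
  have -> : (fun f => s f + t f) = fun f => 1 * s f + t f.
    by apply/funext => f; rewrite mul1r.
  exact: l1_inf_lin.
- move=> _ _ a b [s [t [Ss Tt ->]]] [s' [t' [Ss' Tt' ->]]] ab.
  exists (fun f => a * s f + b * s' f), (fun f => a * t f + b * t' f).
  split; [exact: Sac | exact: Tac|].
  by apply/funext => f; ring.
- by have [s Ss] := Sne; have [t Tt] := Tne; eexists; exists s, t; split.
- move=> u /choice[s /choice[t st]].
  have [g [l [gk Sl sl]]] := Ssc s (fun k => let: And3 h _ _ := st k in h).
  have [h [m [hk Tm tm]]] := Tsc (t \o g) (fun k => let: And3 _ h _ := st (g k) in h).
  exists (g \o h), (fun f => l f + m f); split.
  + by move=> k; apply: leq_trans (gk _).
  + by exists l, m.
  + move=> f; have -> : (fun k => u ((g \o h) k) f) =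
        (fun k => s (g (h k)) f) \+ (fun k => t (g (h k)) f).
      by apply/funext => k /=; have [_ _ ->] := st (g (h k)).
    by apply: cvgD (tm f); apply: cvg_reindex (sl f).
Qed.

Hypothesis noseq : no_l1_seq_wstar_to_delta_inf R F.

(** By contradiction: members of [S] ever smaller on the tests, with coefficients beyond [e], have a
    subsequence whose limit vanishes on all tests, hence is 0. *)
Lemma inf_coef_small S (e : R) : seq_mackey_set S -> 0 < e ->
  exists (m : nat) (d : R), 0 < d /\ forall s, S s ->
    (forall i, (i < m)%N -> `|s (test i)| < d) -> `|inf_coef s| <= e.
Proof.
move=> [SY Sac Sne Ssc] e0; apply: contrapT => none.
have /choice[s sP] : forall m, exists s, [/\ S s,
    forall i, (i < m)%N -> `|s (test i)| < m.+1%:R^-1 & e < `|inf_coef s|].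
  move=> m; apply: contrapT => h; apply: none; exists m, m.+1%:R^-1.
  split; first by rewrite invr_gt0.
  move=> s Ss small; rewrite leNgt; apply/negP => es; apply: h; by exists s.
have [g [l [gk Sl sl]]] := Ssc s (fun k => let: And3 h _ _ := sP k in h).
have l0 : l = fun _ => 0.
  apply: (l1_inf_eq ptE (SY _ Sl) (@l1_inf0 R F)) => i.
  apply: (cvg_unique _ (sl (test i))) => //.
  apply/cvgrPdist_lt => d d0; near=> k; rewrite sub0r normrN.
  have [_ small _] := sP (g k); apply: lt_le_trans (small i _) _.
    by apply: leq_trans (gk k); near: k; exact: nbhs_infty_gt.
  apply: (@le_trans _ _ k.+1%:R^-1); first by rewrite lef_pV2 ?posrE // ler_nat ltnS.
  by apply: ltW; near: k; exact: (near_infty_natSinv_lt (PosNum d0)).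
have /choice[lam /choice[c lamc]] := fun k => SY _ (let: And3 h _ _ := sP (g k) in h).
have cE k : inf_coef (s (g k)) = c k by have [h1 h2] := lamc k; apply: (inf_coefE h1 h2).
have c_gt k : e < `|c k| by rewrite -cE; have [] := sP (g k).
have c_neq0 k : c k != 0 by rewrite -normr_gt0 (lt_trans e0).
(* As [s (g k)] tends to 0 and [c k] stays away from 0, the l1 parts divided by [- c k] tend to the
   evaluation at [KInf]. *)
apply: noseq; exists (fun k n => - (c k)^-1 * lam k n + 0); split=> [k|f].
  by apply: l1seq_lin; [have [] := lamc k | exact: l1seq0].
apply/cvgrPdist_lt => d d0.
have /cvgrPdist_lt/(_ (d * e)) := sl f; rewrite l0 mulr_gt0 // => /(_ isT).
apply: filterS => k /=; rewrite sub0r normrN => sf.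
have [laml1 sE] := lamc k; rewrite l1_apply_linl //; last exact: l1seq0.
rewrite [l1_apply (fun _ => 0) f]pairing0 /delta.
have -> : proj1_sig f KInf - (- (c k)^-1 * l1_apply (lam k) f + 0) = (c k)^-1 * s (g k) f.
  by rewrite sE; field.
rewrite normrM normfV mulrC ltr_pdivrMr ?normr_gt0 //.
by rewrite (lt_trans sf) // ltr_pM2l.
Unshelve. all: by end_near. Qed.

Lemma inf_coef_bound S (e : R) : seq_mackey_set S -> 0 < e ->
  exists (m : nat) (A : R), 0 <= A /\ forall s, S s ->
    `|inf_coef s| <= e + A * \sum_(0 <= i < m) `|s (test i)|.
Proof.
move=> Sgood e0; have [m [d [d0 small]]] := inf_coef_small Sgood e0.
have [SY Sac _ _] := Sgood.
have A0 : 0 <= 2 * e / d by rewrite divr_ge0 ?mulr_ge0 // ltW.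
exists m, (2 * e / d); split => // s Ss.
set Sg := \sum_(0 <= i < m) _; have Sg0 : 0 <= Sg by apply: sumr_ge0.
have sSg i : (i < m)%N -> `|s (test i)| <= Sg.
  move=> im; rewrite /Sg (bigD1_seq i) ?iota_uniq ?mem_index_iota //=.
  by rewrite lerDl sumr_ge0.
have [Sgd|dSg] := ltP Sg d.
  apply: (@le_trans _ _ e); last by rewrite lerDl mulr_ge0.
  by apply: small => // i /sSg; move=> /le_lt_trans; apply.
have Sgp : 0 < Sg := lt_le_trans d0 dSg.
(* This factor keeps [s] in [S] and brings its tests down to at most d / 2; dividing by it yields
   the constant 2 e / d. *)
pose r := d / (2 * Sg); have r0 : 0 < r by rewrite divr_gt0 // mulr_gt0.
have r1 : `|r| <= 1 by rewrite gtr0_norm // ler_pdivrMr ?mulr_gt0 //; lra.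
have := small _ (abs_convexZ Sac r1 Ss); rewrite inf_coefZ; last exact: SY.
rewrite normrM (gtr0_norm r0) => h; have {}h : r * `|inf_coef s| <= e.
  apply: h => i /sSg si; rewrite normrM (gtr0_norm r0).
  apply: (@le_lt_trans _ _ (r * Sg)); first by rewrite ler_wpM2l // ltW.
  have -> : r * Sg = d / 2 by rewrite /r; field; rewrite gt_eqF.
  by lra.
apply: (@le_trans _ _ (2 * e / d * Sg)); last by rewrite lerDr ltW.
have -> : 2 * e / d * Sg = r^-1 * e.
  by rewrite /r; field; rewrite !gt_eqF.
by rewrite ler_pdivlMl.
Qed.

(** Hahn-Banach on the cone over [S], with gauge [r * e] at the [r]-fold of a member, gives a
    combination of the first [m] tests within [e] of [inf_coef] on [S]; this combination is the
    required [f]. *)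
Lemma inf_coef_approx S (e : R) : seq_mackey_set S -> 0 < e ->
  exists f, forall s, S s -> `|inf_coef s - s f| <= e.
Proof.
move=> Sgood e0; have [m [A [A0 bound]]] := inf_coef_bound Sgood e0.
have [SY Sac Sne _] := Sgood.
pose T (a : R) (x : nat -> R) (t : R) := exists s (r : R), [/\ S s, 0 <= r,
  a = r * inf_coef s, x = (fun i => r * s (test i)) & t = r * e].
have [|||c cP] := @Hahn_Banach_finite R A m T A0.
- move=> _ _ _ _ _ _ [s [r [Ss r0 -> -> ->]]] [s' [r' [Ss' r'0 -> -> ->]]].
  have [rr|rr] := eqVneq (r + r') 0.
    have [rz rz'] : r = 0 /\ r' = 0 by split; lra.
    exists s, 0; split => //; rewrite rz rz' ?mul0r ?addr0 //.
    by apply/funext => i; rewrite !mul0r addr0.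
  have rr0 : 0 < r + r' by rewrite lt_neqAle eq_sym rr addr_ge0.
  have split1 : `|r / (r + r')| + `|r' / (r + r')| <= 1.
    by rewrite !ger0_norm ?divr_ge0 ?addr_ge0 // -mulrDl divff.
  (* A sum of two multiples is [r + r'] times a convex combination, which lies in [S]. *)
  exists (fun f => r / (r + r') * s f + r' / (r + r') * s' f), (r + r').
  split => //.
  + exact: Sac.
  + exact: ltW.
  + have sY' : l1_inf (fun f => r' / (r + r') * s' f).
      have [_ [_ [_ YZ]]] := @l1_inf_subspace R F; exact/YZ/SY.
    rewrite (inf_coef_lin _ (SY _ Ss) sY') inf_coefZ; last exact: SY.
    by field.
  + by apply/funext => i; field.
  + by ring.
- move=> l _ _ _ [s [r [Ss r0 -> -> ->]]].
  (* The sign of [l] goes into the member of [S], so that the factor stays nonnegative. *)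
  have sg1 : `|Num.sg l| <= 1 by rewrite normr_sg; case: (_ != 0).
  exists (fun f => Num.sg l * s f), (`|l| * r); split.
  + exact: abs_convexZ.
  + by rewrite mulr_ge0.
  + rewrite inf_coefZ; last exact: SY.
    by rewrite {1}[l]numEsg; ring.
  + by apply/funext => i; rewrite {1}[l]numEsg; ring.
  + by rewrite mulrA.
- move=> _ _ _ [s [r [Ss r0 -> -> ->]]].
  have -> : \sum_(0 <= i < m) `|r * s (test i)| = r * \sum_(0 <= i < m) `|s (test i)|.
    by rewrite mulr_sumr; apply: eq_bigr => i _; rewrite normrM ger0_norm.
  rewrite normrM (ger0_norm r0) mulrCA -mulrDr ler_wpM2l //; exact: bound.
exists (CKsum m c test) => s Ss; rewrite dual_sum; last exact/l1_inf_sub_dual/SY.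
have := cP (inf_coef s) (fun i => s (test i)) e; apply.
exists s, 1; split; rewrite ?mul1r //.
by apply/funext => i; rewrite mul1r.
Qed.

Lemma segment_mackey psi : l1_inf psi -> mackey_set (@l1_inf R F)
  [set phi | exists2 a : R, `|a| <= 1 & phi = fun f => a * psi f].
Proof.
move=> psiY; split; last split.
- by move=> _ [a _ ->]; have [_ [_ [_ YZ]]] := @l1_inf_subspace R F; apply: YZ.
- move=> _ _ a b [a' a'1 ->] [b' b'1 ->] ab; exists (a * a' + b * b').
    apply: le_trans ab; apply: le_trans (ler_normD _ _) _; rewrite !normrM.
    by rewrite lerD // ler_piMr.
  by apply/funext => f; ring.
- exact/segment_wstar_compact/l1_inf_sub_dual.
Qed.

Hypothesis Fad : almost_disjoint_family F.

(** The point [KInf] is a limit of N: finitely many members of [F] leave infinitely many points of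
    any other member uncovered. *)
Lemma CK_KN_eq0 f : (forall n, proj1_sig f (KN n) = 0) -> proj1_sig f KInf = 0.
Proof.
move=> f0; apply/eqP/contraT => finf.
have fp : 0 < `|proj1_sig f KInf| by rewrite normr_gt0.
have [_ [[F0 [F0fin [F0F ->]]] fV]] := proj2_sig f KInf _ fp.
have [Finf [Ninf Fdisj]] := Fad.
have [N [FN F0N]] : exists N, F N /\ ~ F0 N.
  apply: contrapT => h; apply: Finf; apply: sub_finite_set F0fin => N FN.
  by apply: contrapT => F0N; apply: h; exists N.
have /finite_nat_ltP[k kP] : finite_set (\bigcup_(M in F0) (N `&` M)).
  apply: bigcup_finite => // M F0M; apply: Fdisj => //; first exact: F0F.
  by move=> e; rewrite e in F0N.
have [n Nn kn] := (infinite_nat_geP N).1 (Ninf N FN) k.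
have : ~ exists M, F0 M /\ M n.
  move=> [M [F0M Mn]]; have := kP n; rewrite ltnNge kn.
  by move=> /(_ (ex_intro2 _ _ M F0M (conj Nn Mn))).
by move=> /(fV (KN n)); rewrite f0 sub0r normrN ltxx.
Qed.

Lemma l1_inf_mackey_incomplete : ~ mackey_complete (@l1_inf R F).
Proof.
move=> complete.
(* An index pairs a set with a precision: [x p] approximates [inf_coef] on the set within the
   inverse of the number plus 1. *)
pose I := {p : set (CK R F -> R) * nat | seq_mackey_set p.1}.
pose le (p q : I) := (proj1_sig p).1 `<=` (proj1_sig q).1 /\
  ((proj1_sig p).2 <= (proj1_sig q).2)%N.
have /choice[x xP] : forall p : I, exists f, forall s, (proj1_sig p).1 s ->
    `|inf_coef s - s f| <= (proj1_sig p).2.+1%:R^-1.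
  by move=> [[S n] Sgood] /=; apply: inf_coef_approx; rewrite ?invr_gt0.
have directed_le : directed le.
  split; first exact: (inhabits (exist _ ([set fun _ => 0], 0%N) seq_mackey_singleton0)).
  split; first by move=> i; split.
  split.
    move=> i j k [ij1 ij2] [jk1 jk2].
    by split; [move=> s /ij1/jk1 | exact: leq_trans ij2 jk2].
  move=> [[S n] Sgood] [[T m] Tgood].
  exists (exist _ (_, maxn n m) (seq_mackey_sum Sgood Tgood)); rewrite /le /=.
  have [_ Sac Sne _] := Sgood; have [_ Tac Tne _] := Tgood.
  split; (split; last by rewrite leq_max leqnn ?orbT).
    move=> s Ss; exists s, (fun _ => 0); split; rewrite ?abs_convex0 //.
      exact: abs_convex0.
    by apply/funext => f; rewrite addr0.
  move=> s Ts; exists (fun _ => 0), s; split => //; first exact: abs_convex0.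
  by apply/funext => f; rewrite add0r.
have /choice[e_inv e_invP] : forall e : R, exists n : nat, 0 < e -> n.+1%:R^-1 <= e.
  move=> e; have [e0|] := ltP 0 e; last by exists 0%N.
  near \oo => n; exists n => _; apply: ltW; near: n.
  exact: (near_infty_natSinv_lt (PosNum e0)).
have late S (Sgood : seq_mackey_set S) (e : R) i : 0 < e ->
    le (exist _ (S, e_inv e) Sgood) i -> forall s, S s -> `|inf_coef s - s (x i)| <= e.
  move=> e0 [/= Si ni] s Ss; apply: (le_trans (xP i s (Si s Ss))).
  by apply: le_trans (e_invP e e0); rewrite lef_pV2 ?posrE // ler_nat ltnS.
have cauchy : mackey_cauchy (@l1_inf R F) le x.
  move=> S Smackey e e0; have [Sne|/set0P/negP] := pselect (S !=set0); last first.
    (* The empty set also qualifies as a Mackey set; any index serves for it. *)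
    rewrite negbK => /eqP ->.
    by exists (exist _ ([set fun _ => 0], 0%N) seq_mackey_singleton0).
  have e2 : 0 < e / 2 by rewrite divr_gt0.
  have Sgood := mackey_seq_mackey Smackey Sne.
  exists (exist _ (S, e_inv (e / 2)) Sgood) => i j li lj phi Sphi.
  have := late _ _ _ _ e2 li phi Sphi; have := late _ _ _ _ e2 lj phi Sphi.
  rewrite !ler_norml => /andP[? ?] /andP[? ?]; apply/andP; split; lra.
have [z zlim] := complete I le x directed_le cauchy.
(* Convergence on the segment through [psi] determines the value of [psi] at [z]. *)
have zE psi : l1_inf psi -> psi z = inf_coef psi.
  move=> psiY; have Smackey := segment_mackey psiY; set S := [set _ | _] in Smackey.
  have Spsi : S psi.
    by exists 1; rewrite ?normr1 //; apply/funext => f; rewrite mul1r.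
  have Sgood := mackey_seq_mackey Smackey (ex_intro _ psi Spsi).
  apply/eqP; rewrite -subr_eq0; apply/eqP; apply: (@small_multiple_eq0 _ _ 2) => e e0.
  have [i0 i0P] := zlim S Smackey e e0.
  have [i [i0i Si]] := directed_le.2.2.2 i0 (exist _ (S, e_inv e) Sgood).
  have := i0P i i0i psi Spsi; have := late _ _ _ _ e0 Si psi Spsi.
  rewrite !ler_norml => /andP[? ?] /andP[? ?]; apply/andP; split; lra.
have z0 n : proj1_sig z (KN n) = 0.
  have := zE _ (l1_inf_point F n 1); rewrite mul1r => ->.
  apply: (inf_coefE (l1seq_single n 1)) => f; rewrite mul0r addr0.
  rewrite (@l1_applyE _ _ _ (fun m => proj1_sig f (KN m))) //.
  rewrite (@pairing_single _ _ _ n) ?eqxx ?mulr1 // => m /eqP/negbTE ->.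
  by rewrite mulr0 mul0r.
(* Vanishing on N forces the value 0 at [KInf], where the coefficient form requires 1. *)
have := zE _ (l1_inf_delta F 1); rewrite (CK_KN_eq0 z0) mulr0.
rewrite (inf_coefE (@l1seq0 R) (c := 1)) => [/esym/eqP|f]; first by rewrite oner_eq0.
by rewrite [l1_apply _ _]pairing0 add0r.
Unshelve. all: by end_near. Qed.

End mackey_incompleteness.

Theorem theorem4p10 (R : realType) :
  CH ->
  exists F : set (set nat),
    maximal_adf F /\
    no_l1_seq_wstar_to_delta_inf R F /\
    ~ fully_mackey_complete R F.
Proof.
move=> /(CH_recurrent_mass_family R)[F [Fad Fcov Fhump]].
have noseq := recurrent_mass_no_l1_seq Fad Fcov Fhump.
exists F; split; first exact: no_l1_seq_maximal noseq.
split => // complete.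
have /choice[pt ptE] : forall n, exists f : CK R F,
    forall t, proj1_sig f t = \1_[set KN n] t.
  move=> n; have [N FN Nn] := Fcov n.
  by exists (exist _ _ (@Kcont_point R F n N FN Nn)).
apply: (l1_inf_mackey_incomplete ptE noseq Fad); apply: complete.
- exact: l1_inf_subspace.
- exact: l1_inf_norming.
- exact: l1_inf_closed ptE.
Qed.
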